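(* Let $(\iota,H,F)$ be an abstract Wiener space over a Fréchet space and let $\gamma=\nu\circ\iota^{-1}$ be the associated countably additive Gaussian measure on $F$. Then there exist a separable Hilbert space $E$, a countably additive Gaussian measure $\nu_1$ on $E$ with $H(\nu_1)=H$, a continuous linear embedding $j_E\colon H\to E$ with dense range, and a $\nu_1$-a.e. defined, measurable, linear map $L\colon E\to F$, injective at every point of its domain, such that $$\gamma=\nu_1\circ L^{-1},\qquad L\circ j_E=\iota\ \text{ on } H.$$ Equivalently, $L$ is a measure isomorphism between $(E,\nu_1)$ and $(F,\gamma)$ that restricts, under the two embeddings $j_E$ and $\iota$, to the identity map of $H$.
   Context: All spaces are real. For a separable Hilbert space $H$, let $P(H)$ be the set of orthogonal projections in $H$ with finite-dimensional range. The canonical cylindrical Gaussian measure $\nu$ on $H$ is the finitely additive set function on cylinder sets given by $\nu(\{x: Px\in B\})=$ the standard Gaussian measure of $B$ on the Euclidean space $\mathrm{Ran}(P)$, for $P\in P(H)$ and $B\subset\mathrm{Ran}(P)$ Borel. A seminorm $q$ on $H$ is Gross measurable if for every $\varepsilon>0$ there is $P_\varepsilon\in P(H)$ such that $\nu(x\in H: q(Px)>\varepsilon)<\varepsilon$ for all $P\in P(H)$ with $P\perp P_\varepsilon$ (i.e. with range orthogonal to that of $P_\varepsilon$). A triple $(\iota,H,F)$ is an abstract Wiener space (over a Fréchet space) if $F$ is a separable Fréchet space with topology defined by seminorms $q_1\le q_2\le\dots$, $H$ is a separable Hilbert space, $\iota\colon H\to F$ is a continuous linear embedding (injective) with dense range,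 and every seminorm $q_k\circ\iota$ is Gross measurable on $H$. In this case the cylindrical measure $\nu\circ\iota^{-1}$ on $F$ extends uniquely to a countably additive Gaussian Borel measure on $F$, denoted $\gamma=\nu\circ\iota^{-1}$, whose Cameron--Martin space is $\iota(H)$. The Cameron--Martin space of a centered Gaussian measure $\mu$ on a separable Fréchet space $X$ is $H(\mu)=\{h\in X: |h|_{H(\mu)}<\infty\}$, $|h|_{H(\mu)}=\sup\{f(h): f\in X^*,\ \|f\|_{L^2(\mu)}\le1\}$, with this Hilbert norm. ''$H(\nu_1)=H$'' means $j_E(H)=H(\nu_1)$ with $|j_E(h)|_{H(\nu_1)}=|h|_H$. ''$\nu_1$-a.e. defined, linear'' means that $L$ is defined and linear on a linear subspace $E_0\subset E$ of full $\nu_1$-measure; $j_E(H)\subset E_0$ is implied by the identity $L\circ j_E=\iota$ on $H$. ''Injective at every point of its domain'' means that $L$ is injective on $E_0$. A measure isomorphism is a Borel isomorphism between Borel sets of full $\nu_1$-measure in $E$ and of full $\gamma$-measure in $F$ carrying $\nu_1$ to $\gamma$. *)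

(* Defs.v *)
From HB Require Import structures.
From mathcomp Require Import all_boot all_order all_algebra.
From mathcomp Require Import sesquilinear.
From mathcomp Require Import all_classical all_reals all_analysis.

Set Implicit Arguments.
Unset Strict Implicit.
Unset Printing Implicit Defensive.

Import Order.TTheory GRing.Theory Num.Theory.
Import numFieldNormedType.Exports.

Local Open Scope classical_set_scope.
Local Open Scope ring_scope.

Record hilbertType (R : realType) := Hilbert {
  hilbert_space :> completeNormedModType R;
  ip : {dot hilbert_space for idfun};
  ipE : forall x : hilbert_space, ip x x = `|x| ^+ 2 }.

Arguments ip {R} h.

Definition separable (T : topologicalType) :=
  exists2 D : set T, countable D & dense D.

(* [g_sigma_algebraType] asks for a pointed type, which a [tvsType] is not. *)
Definition pointed_tvs (R : realType) (X : tvsType R) : Type := X.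

HB.instance Definition _ (R : realType) (X : tvsType R) :=
  Choice.on (pointed_tvs X).
HB.instance Definition _ (R : realType) (X : tvsType R) :=
  isPointed.Build (pointed_tvs X) (0 : X).

Notation borel X :=
  (g_sigma_algebraType (@open X : set (set (pointed_tvs X)))).

Definition in_dual (R : realType) (X : tvsType R) (f : {linear X -> R^o}) :=
  continuous f.

Definition dense_embedding (R : realType) (X Y : tvsType R)
    (j : {linear X -> Y}) :=
  [/\ continuous j, injective j & dense (range j)].

Definition is_seminorm (R : realType) (V : lmodType R) (q : V -> R) :=
  (forall x y, q (x + y) <= q x + q y) /\
  (forall a x, q (a *: x) = `|a| * q x).

(* Completeness is stated with the seminorms and not with the entourages of
   [F], because a [tvsType] does not require its uniform structure to be the
   translation-invariant one.  Cauchy sequences suffice, as the topology is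
   metrizable. *)
Record frechet (R : realType) (F : tvsType R) (q : nat -> F -> R) : Prop := {
  frechet_seminorm : forall k, is_seminorm (q k);
  frechet_le : forall k x, q k x <= q k.+1 x;
  frechet_nbhs : forall (x : F) (A : set F),
    nbhs x A <-> exists k (e : R), 0 < e /\ [set y | q k (y - x) < e] `<=` A;
  frechet_hausdorff : hausdorff_space F;
  frechet_complete : forall u : nat -> F,
    (forall k (e : R), 0 < e -> exists N, forall m n,
       (N <= m)%N -> (N <= n)%N -> q k (u m - u n) < e) ->
    exists l : F, u @ \oo --> l }.

(* The [n]-fold product of N(0, 1), by recursion on [n]. *)
Fixpoint std_gauss (R : realType) (n : nat) :
    set (n.-tuple (measurableTypeR R)) -> \bar R :=
  match n with
  | 0 => \d_[tuple]
  | m.+1 => pushforward (normal_prob (0 : R) 1 \x @std_gauss R m)%E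
              (fun p => [tuple of p.1 :: p.2])
  end.

Section cylindrical.
Context {R : realType} (H : hilbertType R).

Definition orthonormal n (e : 'I_n -> H) :=
  forall i j, ip H (e i) (e j) = (i == j)%:R.

Definition lin_comb n (e : 'I_n -> H) (t : n.-tuple R) : H :=
  \sum_(i < n) tnth t i *: e i.

Definition fin_proj (P : {linear H -> H}) :=
  [/\ forall x, P (P x) = P x,
      forall x y, ip H (P x) y = ip H x (P y) &
      exists n (e : 'I_n -> H), range P `<=` range (lin_comb e)].

(* The standard Gaussian measure of the Euclidean space Ran(P) is the image of
   that of R^n under the coordinates of any orthonormal basis of Ran(P).  The
   values of [nu] off the cylinder sets are irrelevant. *)
Definition canonical_gaussian (nu : set H -> \bar R) :=
  forall P : {linear H -> H}, fin_proj P ->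
  forall n (e : 'I_n -> H), orthonormal e -> range (lin_comb e) = range P ->
  forall B : set (borel H), measurable B ->
    nu [set x | B (P x)] = std_gauss [set t | B (lin_comb e t)].

Definition gross_measurable (nu : set H -> \bar R) (q : H -> R) :=
  forall eps : R, 0 < eps -> exists Peps : {linear H -> H},
    fin_proj Peps /\
    forall P : {linear H -> H}, fin_proj P ->
      (forall x y, ip H (P x) (Peps y) = 0) ->
      (nu [set x | (eps < q (P x))%R] < eps%:E)%E.

Record abstract_wiener_space (F : tvsType R) (q : nat -> F -> R)
    (nu : set H -> \bar R) (iota : {linear H -> F}) : Prop := {
  aws_frechet : frechet q;
  aws_separableF : separable F;
  aws_separableH : separable H;
  aws_embedding : dense_embedding iota;
  aws_gross : forall k, gross_measurable nu (q k \o iota) }.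

(* [gamma] is the countably additive extension of the image of [nu] under
   [iota] : the two agree on the cylinder sets {x | (f_i x)_i \in B} of [F]. *)
Definition extends_image (F : tvsType R) (nu : set H -> \bar R)
    (iota : {linear H -> F}) (gamma : probability (borel F) R) :=
  forall n (f : 'I_n -> {linear F -> R^o})
    (B : set (n.-tuple (measurableTypeR R))),
  (forall i, in_dual (f i)) -> measurable B ->
  let C := [set x : F | B [tuple f i x | i < n]] in
  gamma C = nu (iota @^-1` C).

End cylindrical.

Section gaussian.
Context {R : realType} (X : tvsType R) (mu : probability (borel X) R).

(* The Dirac case is separate because [normal_prob 0 0] is not a Dirac mass. *)
Definition centered_gaussian :=
  forall f : {linear X -> R^o}, in_dual f ->
    (exists2 s : R, 0 < s & forall B : set (measurableTypeR R), measurable B ->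
       mu (f @^-1` B) = normal_prob 0 s B) \/
    (forall B : set (measurableTypeR R), measurable B ->
       mu (f @^-1` B) = \d_(0 : R) B).

Definition cm_norm (h : X) : \bar R :=
  ereal_sup [set (f h)%:E | f in [set f : {linear X -> R^o} |
    in_dual f /\ (Lnorm mu 2%:E (fun x => (f x)%:E) <= 1)%E]].

Definition cm_space : set X := [set h | (cm_norm h < +oo)%E].

End gaussian.

(* A partial map is a total function together with its domain [D] ; its values
   off [D] are irrelevant. *)
Definition linear_on (R : realType) (X Y : lmodType R) (D : set X)
    (L : X -> Y) :=
  [/\ D 0, forall a x y, D x -> D y -> D (a *: x + y) &
      forall a x y, D x -> D y -> L (a *: x + y) = a *: L x + L y].

Definition measure_isomorphism d1 d2 (T1 : measurableType d1)
    (T2 : measurableType d2) (R : realType) (mu1 : probability T1 R)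
    (mu2 : probability T2 R) (D1 : set T1) (D2 : set T2) (L : T1 -> T2) :=
  [/\ [/\ measurable D1, mu1 D1 = 1%E, measurable D2 & mu2 D2 = 1%E],
      set_bij D1 D2 L,
      measurable_fun D1 L,
      (forall A, measurable A -> A `<=` D1 -> measurable (L @` A)) &
      forall B, measurable B -> mu2 B = mu1 (D1 `&` L @^-1` B)].

(* Main.v *)
Require Import Defs.
From HB Require Import structures.
From mathcomp Require Import all_boot all_order all_algebra.
From mathcomp Require Import sesquilinear.
From mathcomp Require Import all_classical all_reals all_analysis.
From mathcomp Require Import measurable_realfun.
From mathcomp Require Import lra ring.

(** The Hilbert space [E] is [H] itself, with an embedding [j] that is diagonal:
    it multiplies the [i]-th coordinate in a suitable orthonormal system [e] by a
    small number [a i > 0].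

    The system is chosen as follows.  By the Hahn-Banach theorem, countably many
    continuous functionals [g n] determine the seminorms of [F]
    ([norming_sequence]).  Each of them is represented by a vector of [H], and
    Gram-Schmidt turns these vectors into a total system [e], orthonormal up to
    vanishing members, whose members are represented by functionals [f i] of [F] as well
    ([gaussian_basis]).  The proof rests on the convergence, along a subsequence
    [s N] and for [gamma]-almost every [y], of the partial sums
    [S n y = sum_(i < n) f i y *: iota (e i)] to [y].

    To see it, consider the reflection [y |-> 2 *: S n y - y].  It reverses the
    sign of the [f i] with [n <= i], which are independent centered Gaussian
    variables, so it preserves [gamma] ([canonical_gaussian_flip],
    [reflection_invariant]).  It fixes the [g m] with [m < n], so an event that
    depends on finitely many of the [g m] is invariant for all large [n].  The
    events that are invariant up to a set whose measure tends to 0 form a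
    sigma-algebra ([sigma_algebra_asy_invariant]), hence all Borel sets are of
    this kind, in particular small balls.  Covering [F] by small balls, one finds
    that [y] and its reflection are close to each other with a probability that
    tends to 1 ; but [y - S n y] is half their difference
    ([expansion_cvg_measure]), and the Borel-Cantelli lemma yields [s].

    If the [a i] are small enough then [T y = sum_i a i * f i y *: e i] converges
    in [H] for almost every [y].  The measure [nu1] is the image of [gamma] under
    [T], and [L x] is the limit of
    [sum_(i < s N) (a i)^-1 * <x, e i> *: iota (e i)] where it exists in [F].  By
    the convergence above, [T] and [L] are inverse to each other between Borel
    sets of full measure ([analysisK], [synthesisK]), whence all that is claimed of
    [L] ; and [L (j h) = iota h] because [h] is the sum of its expansion in [H].

    A continuous functional [phi] of [H], composed with [T], is almost everywhere
    the limit of functionals of [F] with normal laws, so it has a normal law, of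
    deviation [`|w|] where [w] represents [phi \o j] ([law_of_limit],
    [hilbert_law_normal]).  The supremum that defines the Cameron-Martin norm
    therefore ranges over the [w] of norm at most 1, which gives [`|h|] at [j h] and
    a finite value at no point outside [range j] ([cm_norm_diagonal],
    [cm_space_diagonal]). *)

Set Implicit Arguments.
Unset Strict Implicit.
Unset Printing Implicit Defensive.

Import Order.TTheory GRing.Theory Num.Theory.
Import numFieldNormedType.Exports.

Local Open Scope classical_set_scope.
Local Open Scope ring_scope.

(** * A Hahn-Banach theorem for seminorms *)

Section hahn_banach.
Context {R : realType} (V : lmodType R).
Implicit Types (p q : V -> R) (x y z : V).

Definition sublinear p :=
  (forall x y, p (x + y) <= p x + p y) /\
  (forall a x, 0 <= a -> p (a *: x) = a * p x).

Lemma inf_leD (S A B : set R) : has_lbound S -> A !=set0 -> B !=set0 ->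
  (forall a b, A a -> B b -> exists2 s, S s & s <= a + b) ->
  inf S <= inf A + inf B.
Proof.
move=> Sl A0 B0 SAB; rewrite -lerBlDr; apply: lb_le_inf => // a Aa.
rewrite lerBlDr -lerBlDl; apply: lb_le_inf => // b Bb.
have [s Ss sab] := SAB _ _ Aa Bb.
by rewrite lerBlDl (le_trans _ sab)// ge_inf.
Qed.

Lemma inf_leM (S A : set R) c : 0 < c -> has_lbound S -> A !=set0 ->
  (forall a, A a -> exists2 s, S s & s <= c * a) -> inf S <= c * inf A.
Proof.
move=> c0 Sl A0 SA; rewrite -ler_pdivrMl//; apply: lb_le_inf => // a Aa.
have [s Ss sa] := SA _ Aa.
by rewrite ler_pdivrMl// (le_trans _ sa)// ge_inf.
Qed.

Lemma sublinear0 p : sublinear p -> p 0 = 0.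
Proof. by case=> _ /(_ 0 0 (lexx _)); rewrite scale0r mul0r. Qed.

Lemma sublinear_ge p : sublinear p -> forall x, - p (- x) <= p x.
Proof.
move=> sp x; rewrite lerNl -subr_ge0 opprK -(sublinear0 sp) -[X in p X](addNr x).
exact: sp.1.
Qed.

Lemma sublinearP p : (forall x y, p (x + y) <= p x + p y) -> 0 <= p 0 ->
  (forall a x, 0 < a -> p (a *: x) <= a * p x) -> p 0 <= 0 -> sublinear p.
Proof.
move=> pD p0 pZ p0'; split=> // a x; rewrite le_eqVlt => /predU1P[<-|a0].
  by rewrite scale0r mul0r; apply/eqP; rewrite eq_le p0 p0'.
apply/eqP; rewrite eq_le pZ//= -ler_pdivlMl//.
by rewrite -{1}[x](scalerK (lt0r_neq0 a0)) pZ// invr_gt0.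
Qed.

(** The largest sublinear functional below [p] whose value at [- y] is at most
    [- p y].  A minimal sublinear functional coincides with all of its
    modifications of this kind, and therefore is additive. *)
Definition flatten_along p y x :=
  inf [set p (x + t *: y) - t * p y | t in [set t | 0 <= t]].

Lemma flatten_along_lbound p y x : sublinear p ->
  has_lbound [set p (x + t *: y) - t * p y | t in [set t | 0 <= t]].
Proof.
move=> sp; exists (- p (- x)) => _ [t /= t0 <-].
rewrite lerBrDr addrC lerBlDr -sp.2//.
by have := sp.1 (x + t *: y) (- x); rewrite addrC addKr.
Qed.

Lemma flatten_along_nonempty p y x :
  [set p (x + t *: y) - t * p y | t in [set t | 0 <= t]] !=set0.
Proof. by exists (p (x + 0 *: y) - 0 * p y); exists 0 => /=. Qed.

Lemma flatten_along_le p y x t : sublinear p -> 0 <= t ->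
  flatten_along p y x <= p (x + t *: y) - t * p y.
Proof. by move=> sp t0; apply: ge_inf; [exact: flatten_along_lbound|exists t]. Qed.

Lemma sublinear_flatten_along p y : sublinear p -> sublinear (flatten_along p y).
Proof.
move=> sp; have f0 : flatten_along p y 0 = 0.
  apply/eqP; rewrite eq_le; apply/andP; split.
    have := flatten_along_le y 0 sp (lexx 0).
    by rewrite scale0r mul0r addr0 subr0 (sublinear0 sp).
  apply: lb_le_inf; first exact: flatten_along_nonempty.
  by move=> _ [t t0 <-]; rewrite add0r sp.2// subrr.
apply: sublinearP; rewrite ?f0//; last first.
  move=> a x a0.
  apply: inf_leM => //; [exact: flatten_along_lbound|exact: flatten_along_nonempty|].
  move=> _ [t /= t0 <-]; exists (p (a *: x + (a * t) *: y) - (a * t) * p y).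
    by exists (a * t) => //=; rewrite mulr_ge0// ltW.
  by rewrite -scalerA -scalerDr (sp.2 _ _ (ltW a0)) mulrBr mulrA.
move=> x z; apply: inf_leD;
  [exact: flatten_along_lbound|exact: flatten_along_nonempty..|].
  move=> _ _ [t /= t0 <-] [s /= s0 <-].
  exists (p (x + z + (t + s) *: y) - (t + s) * p y).
    by exists (t + s) => //=; rewrite addr_ge0.
  have := sp.1 (x + t *: y) (z + s *: y).
  by rewrite addrACA -scalerDl; lra.
Qed.

Lemma flatten_along_id p y x : sublinear p -> flatten_along p y x <= p x.
Proof.
move=> sp; have := flatten_along_le y x sp (lexx 0).
by rewrite scale0r mul0r addr0 subr0.
Qed.

(** Subadditivity of the infimum uses that two elements of a chain are
    comparable: the smaller one bounds the infimum at both points. *)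
Lemma sublinear_inf (q : V -> R) (A : set (V -> R)) : A !=set0 ->
  total_on A (fun p p' => forall x, p' x <= p x) ->
  (forall p, A p -> sublinear p /\ forall x, p x <= q x) ->
  sublinear (fun x => inf [set p x | p in A]) /\
  forall p, A p -> forall x, inf [set p x | p in A] <= p x.
Proof.
move=> A0 Atot Aq.
have lbA x : has_lbound [set p x | p in A].
  exists (- q (- x)) => _ [p Ap <-]; have [sp pq] := Aq _ Ap.
  by rewrite (le_trans _ (sublinear_ge sp x))// lerN2.
have neA x : [set p x | p in A] !=set0 by case: A0 => p Ap; exists (p x), p.
split; last by move=> p Ap x; apply: ge_inf => //; exists p.
have i0 : inf [set p 0 | p in A] = 0.
  rewrite (_ : [set p 0 | p in A] = [set 0]) ?inf1//.
  apply/seteqP; split=> [_ [p /Aq[sp _] <-]|_ ->]; first exact: sublinear0.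
  by case: A0 => p Ap; exists p => //; apply: sublinear0; case: (Aq _ Ap).
apply: sublinearP; rewrite ?i0//; last first.
  move=> a x a0.
  apply: inf_leM => // _ [p Ap <-]; exists (p (a *: x)); first by exists p.
  by rewrite ((Aq _ Ap).1.2 _ _ (ltW a0)).
move=> x y; apply: inf_leD => // _ _ [p Ap <-] [p' Ap' <-].
have [[pD _] _] := Aq _ Ap; have [[pD' _] _] := Aq _ Ap'.
case: (Atot _ _ Ap Ap') => pp'.
  by exists (p' (x + y)); [exists p'|rewrite (le_trans (pD' _ _))// lerD2r].
by exists (p (x + y)); [exists p|rewrite (le_trans (pD _ _))// lerD2l].
Qed.

Lemma minimal_sublinear q : sublinear q -> exists p, [/\ sublinear p,
  forall x, p x <= q x & forall p', sublinear p' -> (forall x, p' x <= p x) -> p' = p].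
Proof.
move=> sq.
pose T := {p : V -> R | sublinear p /\ forall x, p x <= q x}.
pose rel (p p' : T) := `[< forall x, sval p' x <= sval p x >].
have [t|r s t /asboolP rs /asboolP st|A Atot|[p [sp pq]] pmax] := @ZL_preorder T
  (exist _ q (conj sq (fun x => lexx _))) rel.
- exact/asboolP.
- by apply/asboolP => x; exact: le_trans (st x) (rs x).
- have [A0|/set0P A0] := eqVneq A set0.
    by exists (exist _ q (conj sq (fun x => lexx _))); rewrite A0.
  pose B := [set sval t | t in A].
  have [|||sB leB] := @sublinear_inf q B.
  + by case: A0 => t At; exists (sval t), t.
  + move=> _ _ [t At <-] [t' At' <-].
    by case: (Atot _ _ At At') => /asboolP ?; [left|right].
  + by move=> _ [[t tP] At <-].
  have Bq x : inf [set p x | p in B] <= q x.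
    case: A0 => -[t [st tq]] At.
    by rewrite (le_trans _ (tq x))// leB//; exists (exist _ t (conj st tq)).
  exists (exist _ (fun x => inf [set p x | p in B]) (conj sB Bq)) => s As.
  by apply/asboolP => x /=; apply: leB; exists s.
exists p; split=> // p' sp' p'p.
have p'q x : p' x <= q x by rewrite (le_trans (p'p x)).
have /asboolP pp' := pmax (exist _ p' (conj sp' p'q)) (asboolT p'p).
by apply/funext => x; apply/eqP; rewrite eq_le p'p pp'.
Qed.

Lemma minimal_sublinear_additive p : sublinear p ->
  (forall p', sublinear p' -> (forall x, p' x <= p x) -> p' = p) ->
  forall x y, p (x + y) = p x + p y.
Proof.
move=> sp pmin x y; apply/eqP; rewrite eq_le sp.1/= -lerBrDr.
rewrite -{1}(pmin _ (sublinear_flatten_along y sp) (fun x => flatten_along_id y x sp)).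
by have := flatten_along_le y x sp ler01; rewrite scale1r mul1r.
Qed.

(** A minimal sublinear functional below [flatten_along q d] is linear, and its
    value at [- d] is at most [- q d], which makes it equal to [q] at [d]. *)
Lemma hahn_banach_seminorm q d : is_seminorm q ->
  exists f : {linear V -> R^o}, (forall x, `|f x| <= q x) /\ f d = q d.
Proof.
move=> [qD qZ].
have sq : sublinear q by split=> // a x a0; rewrite qZ ger0_norm.
have [p [sp pq pmin]] := minimal_sublinear (sublinear_flatten_along d sq).
have pD := minimal_sublinear_additive sp pmin.
have pN x : p (- x) = - p x.
  by apply/eqP; rewrite -subr_eq0 opprK -pD addNr sublinear0.
have pZ a x : p (a *: x) = a * p x.
  have [a0|a0] := leP 0 a; first exact: sp.2.
  by rewrite -[a]opprK scaleNr pN sp.2 ?mulNr ?opprK // oppr_ge0 ltW.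
have plin : linear (p : V -> R^o) by move=> a x y; rewrite pD pZ.
pose L := GRing.isLinear.Build _ _ _ _ (p : V -> R^o) plin.
pose f : {linear V -> R^o} := HB.pack (p : V -> R^o) L.
have pq' x : p x <= q x by rewrite (le_trans (pq x))// flatten_along_id.
have fE x : f x = p x by [].
exists f; split=> [x|]; rewrite fE.
  rewrite ler_norml pq' andbT lerNl -pN; apply: (le_trans (pq' _)).
  by rewrite -scaleN1r qZ normrN1 mul1r.
apply/eqP; rewrite eq_le pq'/= -lerN2 -pN (le_trans (pq _))//.
have := flatten_along_le d (- d) sq ler01.
by rewrite scale1r addNr mul1r (sublinear0 sq) sub0r.
Qed.

End hahn_banach.

(** * Frechet spaces and their Borel sets *)

Section dense_sequence.

Lemma separable_dense_sequence (T : topologicalType) : T -> separable T ->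
  exists d : nat -> T, forall U : set T, open U -> U !=set0 -> exists n, U (d n).
Proof.
move=> x0 [D /pfcard_geP[D0|[d]] Dd].
  by have [x []] := Dd setT (ex_intro _ x0 I) openT; rewrite D0.
exists d => U Uo U0; have [x [Ux Dx]] := Dd U U0 Uo.
by have [n _ dn] := 'surj_d Dx; exists n; rewrite dn.
Qed.

End dense_sequence.

Section frechet_theory.
Context {R : realType} {F : tvsType R} {q : nat -> F -> R}.
Hypothesis frF : frechet q.
Implicit Types (x y : F) (k : nat).

Let qD k x y : q k (x + y) <= q k x + q k y.
Proof. exact: (frechet_seminorm frF k).1. Qed.

Let qZ k a x : q k (a *: x) = `|a| * q k x.
Proof. exact: (frechet_seminorm frF k).2. Qed.

Lemma fnorm0 k : q k 0 = 0.
Proof. by rewrite -(scale0r 0) qZ normr0 mul0r. Qed.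

Lemma fnormN k x : q k (- x) = q k x.
Proof. by rewrite -scaleN1r qZ normrN1 mul1r. Qed.

Lemma fnormBC k x y : q k (x - y) = q k (y - x).
Proof. by rewrite -fnormN opprB. Qed.

Lemma fnorm_ge0 k x : 0 <= q k x.
Proof. by have := qD k x (- x); rewrite subrr fnorm0 fnormN; lra. Qed.

Lemma fnorm_le k l x : (k <= l)%N -> q k x <= q l x.
Proof.
move=> /subnK <-; elim: (l - k)%N => // n; rewrite addSn => /le_trans; apply.
exact: frechet_le frF _ _.
Qed.

Lemma fnorm_triangle k x y z : q k (x - z) <= q k (x - y) + q k (y - z).
Proof. by have := qD k (x - y) (y - z); rewrite addrA subrK. Qed.

Lemma fnorm_lip k x y : `|q k x - q k y| <= q k (x - y).
Proof.
have := qD k (x - y) y; have := qD k (y - x) x; rewrite !subrK fnormBC ler_norml.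
lra.
Qed.

Lemma frechet_near x k e : 0 < e -> nbhs x [set y | q k (y - x) < e].
Proof. by move=> e0; apply/(frechet_nbhs frF); exists k, e; split. Qed.

Lemma fnorm_continuous k : continuous (q k : F -> R).
Proof.
move=> x; apply/cvgrPdist_lt => e e0; near=> y.
by rewrite (le_lt_trans (fnorm_lip _ _ _))// fnormBC; near: y; exact: frechet_near.
Unshelve. all: by end_near. Qed.

Lemma open_fball k a e : open [set y : F | q k (y - a) < e].
Proof.
rewrite openE => x /= xa; rewrite /interior /=.
have e0 : 0 < e - q k (x - a) by rewrite subr_gt0.
apply: filterS (frechet_near x k e0) => y /=; rewrite ltrBrDr.
by apply: le_lt_trans; exact: fnorm_triangle.
Qed.

Lemma frechet_cvgP (u : nat -> F) l : u @ \oo --> l <->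
  forall k e, 0 < e -> \forall n \near \oo, q k (u n - l) < e.
Proof.
split=> [ul k e e0|ul A /(frechet_nbhs frF)[k [e [e0 eA]]]].
  by apply: (ul [set y | q k (y - l) < e]); exact: frechet_near.
by apply: filterS (ul k e e0) => n; exact: eA.
Qed.

Lemma frechet_cvg_fnorm (u : nat -> F) l k a :
  u @ \oo --> l -> q k (u n - a) @[n --> \oo] --> q k (l - a).
Proof.
move=> /frechet_cvgP ul; apply/cvgrPdist_lt => e e0.
move: (ul k e e0); apply: filterS => n ne.
rewrite (le_lt_trans (fnorm_lip _ _ _))//.
by rewrite opprB addrA subrK fnormBC.
Qed.

Lemma frechet_eq0 x : (forall k, q k x = 0) -> x = 0.
Proof.
move=> x0; apply/esym/(frechet_hausdorff frF) => A B.
move=> /(frechet_nbhs frF)[k [e [e0 eA]]] /nbhs_singleton Bx.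
by exists x; split=> //; apply: eA; rewrite /= subr0 x0.
Qed.

Lemma frechet_cvg_unique (u : nat -> F) (l l' : F) :
  u @ \oo --> l -> u @ \oo --> l' -> l = l'.
Proof.
move=> ul ul'.
exact: (@cvg_unique _ (frechet_hausdorff frF) (u @ \oo) _ _ _ ul ul').
Qed.

Lemma fnormB_cvg0 (u : nat -> F) l : u @ \oo --> l <->
  forall k, q k (u n - l) @[n --> \oo] --> (0 : R).
Proof.
rewrite frechet_cvgP; split=> ul k.
  apply/cvgrPdist_lt => e e0; move: (ul k e e0); apply: filterS => n.
  by rewrite sub0r normrN ger0_norm// fnorm_ge0.
move=> e e0; have /cvgrPdist_lt/(_ e e0) := ul k; apply: filterS => n.
by rewrite sub0r normrN ger0_norm// fnorm_ge0.
Qed.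

Definition frechet_cauchy (u : nat -> F) := forall k (e : R), 0 < e ->
  exists N, forall m n, (N <= m)%N -> (N <= n)%N -> q k (u m - u n) < e.

Lemma frechet_cvg_cauchy (u : nat -> F) (l : F) : u @ \oo --> l -> frechet_cauchy u.
Proof.
move=> /frechet_cvgP ul k e e0.
have e20 : 0 < e / 2 by rewrite divr_gt0.
have [N _ Nl] := ul k (e / 2) e20.
exists N => m n Nm Nn; rewrite (le_lt_trans (fnorm_triangle _ _ l _))//.
by rewrite [e]splitr ltrD ?Nl// fnormBC Nl.
Qed.

End frechet_theory.

Section frechet_measurable.
Context {R : realType} {F : tvsType R} {q : nat -> F -> R}.
Hypothesis frF : frechet q.
Hypothesis sepF : Defs.separable F.

Lemma frechet_dense_sequence : exists d : nat -> F,
  forall x k e, 0 < e -> exists n, q k (x - d n) < e.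
Proof.
have [d dd] := separable_dense_sequence (0 : F) sepF.
exists d => x k e e0; have [||n /= nd] := dd [set y | q k (y - x) < e].
- exact: open_fball.
- by exists x; rewrite /= subrr fnorm0.
- by exists n; rewrite (fnormBC frF).
Qed.

Lemma frechet_open_bigcup : exists d : nat -> F, forall U : set F, open U ->
  U = \bigcup_k \bigcup_m \bigcup_(n in
        [set n | [set y | q k (y - d n) < m.+1%:R^-1] `<=` U])
      [set y | q k (y - d n) < m.+1%:R^-1].
Proof.
have [d dd] := frechet_dense_sequence; exists d => U Uo.
apply/seteqP; split=> [x Ux|x [k _ [m _ [n]]]]; last exact.
have /(frechet_nbhs frF)[k [e [e0 eU]]] : nbhs x U by exact: open_nbhs_nbhs.
have e20 : 0 < e / 2 by rewrite divr_gt0.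
have [m me] := ltr_add_invr e20; rewrite add0r in me.
have [n nd] := dd x k (m.+1%:R^-1) (ltac:(by rewrite invr_gt0)).
exists k => //; exists m => //; exists n => //= y /= yd.
apply: eU; rewrite /= (le_lt_trans (fnorm_triangle frF _ _ (d n) _))//.
by rewrite [e]splitr ltrD// ?(lt_trans yd)// fnormBC// (lt_trans nd).
Qed.

(** In a separable space every open set is a countable union of balls, so that
    only the distances to fixed points have to be measurable. *)
Lemma measurable_into_frechet d (T : measurableType d) (D : set T)
    (g : T -> borel F) :
  (forall k a, measurable_fun D (fun t => q k (g t - a) : R)) ->
  measurable_fun D g.
Proof.
move=> mg mD; have [s sE] := frechet_open_bigcup.
move: (mD); apply: (@measurability _ _ T (borel F) D g (@open F)) => // _ [U Uo <-].
rewrite (sE _ Uo) preimage_bigcup setI_bigcupr; apply: bigcup_measurable => k _.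
rewrite preimage_bigcup setI_bigcupr; apply: bigcup_measurable => m _.
rewrite preimage_bigcup setI_bigcupr; apply: bigcup_measurable => n _.
have := mg k (s n) mD `]-oo, m.+1%:R^-1[%classic (measurable_itv _).
by congr measurable; congr setI; apply/seteqP; split=> t /=; rewrite in_itv.
Qed.

Lemma measurable_frechet_lim d (T : measurableType d) (D : set T)
    (u : nat -> T -> F) (g : T -> borel F) :
  (forall n k a, measurable_fun D (fun t => q k (u n t - a) : R)) ->
  (forall t, D t -> u^~ t @ \oo --> (g t : F)) ->
  measurable_fun D g.
Proof.
move=> mu ug; apply: measurable_into_frechet => k a.
apply: measurable_fun_cvg; first by move=> n; exact: (mu n k a).
by move=> t Dt; apply: frechet_cvg_fnorm => //; exact: ug.
Qed.

End frechet_measurable.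

Section borel_measurable.
Context {R : realType}.

Lemma borel_open (X : tvsType R) (U : set X) :
  open U -> measurable (U : set (borel X)).
Proof. exact: sub_sigma_algebra. Qed.

Lemma continuous_borel (X Y : tvsType R) (f : X -> Y) :
  continuous f -> measurable_fun setT (f : borel X -> borel Y).
Proof.
move=> cf.
apply: (@measurability _ _ (borel X) (borel Y) setT f (@open Y)) => // _ [U Uo <-].
by rewrite setTI; apply: borel_open; exact: open_comp.
Qed.

Lemma continuous_borel_real (X : tvsType R) (f : X -> R) :
  continuous f -> measurable_fun setT (f : borel X -> R).
Proof.
move=> cf; apply: (measurability _ (RGenOpens.measurableE R)) => _ [_ [a [b ->]] <-].
rewrite setTI; apply: borel_open; apply: open_comp => //.
Qed.

Context d (T : measurableType d) (v : nat -> T -> R).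
Hypothesis mv : forall n, measurable_fun setT (v n).

Lemma measurable_cvg0 : measurable [set t | v n t @[n --> \oo] --> (0 : R)].
Proof.
rewrite (_ : [set _ | _] = \bigcap_j \bigcup_N \bigcap_(n in [set n | (N <= n)%N])
   [set t | `|v n t| < j.+1%:R^-1]).
  apply: bigcapT_measurable => j; apply: bigcupT_measurable => N.
  apply: bigcap_measurableType => n _; rewrite -[X in measurable X]setTI.
  rewrite (_ : [set t | _] = (fun t => `|v n t|) @^-1` `]-oo, j.+1%:R^-1[).
    by apply: (measurableT_comp (@normr_measurable _ setT) (mv n)).
  by apply/seteqP; split=> t /=; rewrite in_itv.
apply/seteqP; split=> t /=.
  move=> /cvgrPdist_lt vt j _; have [|N _ Nv] := vt j.+1%:R^-1.
    by rewrite invr_gt0.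
  by exists N => // n /Nv; rewrite sub0r normrN.
move=> vt; apply/cvgrPdist_lt => e e0.
have [j je] := ltr_add_invr e0; rewrite add0r in je.
have [N _ Nv] := vt j I; exists N => // n /Nv /= vn.
by rewrite sub0r normrN (lt_trans vn).
Qed.

End borel_measurable.

Lemma measurable_frechet_cauchy {R : realType} {F : tvsType R}
    (q : nat -> F -> R) d (T : measurableType d) (u : nat -> T -> F) :
  (forall k m n, measurable_fun setT (fun t => q k (u m t - u n t) : R)) ->
  measurable [set t | frechet_cauchy (q := q) (u^~ t)].
Proof.
move=> mq.
rewrite (_ : [set _ | _] = \bigcap_k \bigcap_j \bigcup_N
   \bigcap_(m in [set m | (N <= m)%N]) \bigcap_(n in [set n | (N <= n)%N])
   [set t | q k (u m t - u n t) < j.+1%:R^-1]).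
  apply: bigcapT_measurable => k; apply: bigcapT_measurable => j.
  apply: bigcupT_measurable => N; apply: bigcap_measurableType => m _.
  apply: bigcap_measurableType => n _; rewrite -[X in measurable X]setTI.
  rewrite (_ : [set t | _] = (fun t => q k (u m t - u n t)) @^-1` `]-oo, j.+1%:R^-1[).
    exact: mq.
  by apply/seteqP; split=> t /=; rewrite in_itv.
apply/seteqP; split=> t /=.
  move=> ct k _ j _; have [|N Nu] := ct k j.+1%:R^-1; first by rewrite invr_gt0.
  by exists N => // m Nm n Nn; exact: Nu.
move=> ct k e e0; have [j je] := ltr_add_invr e0; rewrite add0r in je.
have [N _ Nu] := ct k I j I; exists N => m n Nm Nn.
by rewrite (lt_trans _ je)//; exact: Nu.
Qed.

(** * Norming sequences of functionals *)

Section functionals.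
Context {R : realType} {V : lmodType R} (f : {linear V -> R^o}).

Lemma dualB x y : f (x - y) = (f x : R) - (f y : R) :> R.
Proof. exact: linearB. Qed.

Lemma dualD x y : f (x + y) = (f x : R) + (f y : R) :> R.
Proof. exact: linearD. Qed.

Lemma dualZ a x : f (a *: x) = a * (f x : R) :> R.
Proof. exact: linearZ. Qed.

Lemma dual_sum (I : Type) (r : seq I) (P : pred I) (E : I -> V) :
  f (\sum_(i <- r | P i) E i) = \sum_(i <- r | P i) (f (E i) : R) :> R.
Proof. exact: linear_sum. Qed.

End functionals.

Section norming_sequence.
Context {R : realType} {F : tvsType R} {q : nat -> F -> R}.
Hypothesis frF : frechet q.
Hypothesis sepF : Defs.separable F.

Lemma dominated_linear_continuous k (f : {linear F -> R^o}) :
  (forall x, `|f x| <= q k x) -> continuous f.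
Proof.
move=> fq x; apply/cvgrPdist_lt => e e0; near=> y.
rewrite -dualB (le_lt_trans (fq _))// (fnormBC frF).
by near: y; exact: frechet_near.
Unshelve. all: by end_near. Qed.

(** A functional that attains the seminorm at one point of a dense sequence
    nearly attains it at all the points close by. *)
Lemma norming_sequence : exists g : nat -> {linear F -> R^o},
  (forall n, continuous (g n)) /\
  forall k x e, 0 < e ->
    exists2 n, (forall y, `|g n y| <= q k y) & q k x - e < g n x.
Proof.
have [d dd] := frechet_dense_sequence frF sepF.
have /choice[G GP] (ki : nat * nat) : exists f : {linear F -> R^o},
    (forall x, `|f x| <= q ki.1 x) /\ f (d ki.2) = q ki.1 (d ki.2).
  exact/hahn_banach_seminorm/(frechet_seminorm frF).
exists (fun n => G (odflt (0, 0)%N (unpickle n))); split=> [n|k x e e0].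
  by apply: dominated_linear_continuous; exact: (GP _).1.
have e20 : 0 < e / 2 by rewrite divr_gt0.
have [i xi] := dd x k (e / 2) e20.
exists (pickle (k, i)); rewrite pickleK/=; first exact: (GP (k, i)).1.
have [Gq Gd] := GP (k, i); rewrite /= in Gq Gd.
have := Gq (x - d i); rewrite dualB Gd ler_norml => /andP[+ _].
have := fnorm_lip frF k x (d i); rewrite ler_norml => /andP[_].
lra.
Qed.

Section generated.
Variable g : nat -> {linear F -> R^o}.
Hypothesis gP : forall k x e, 0 < e ->
    exists2 n, (forall y, `|g n y| <= q k y) & q k x - e < g n x.

Lemma norming_separates x : (forall n, g n x = 0) -> x = 0.
Proof.
move=> g0; apply: (frechet_eq0 frF) => k; apply/eqP.
rewrite eq_le fnorm_ge0// andbT; apply/ler_addgt0Pr => e e0.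
by have [n _] := gP k x e0; rewrite g0; lra.
Qed.

(** The gap [m.+1%:R^-1] makes the strict inequality a countable union of
    families of non-strict ones. *)
Lemma norming_ball k a r : [set y | q k (y - a) < r] =
  \bigcup_m \bigcap_(n in [set n | forall y, `|g n y| <= q k y])
    [set y | (g n y : R) <= (g n a : R) + r - m.+1%:R^-1].
Proof.
apply/seteqP; split=> y /=.
  rewrite -subr_gt0 => /ltr_add_invr[m]; rewrite add0r => mr.
  exists m => // n /= /(_ (y - a)); rewrite dualB ler_norml => /andP[_].

  by move: mr; move: (_.+1%:R^-1) => c; lra.
move=> [m _ my]; apply: (@le_lt_trans _ _ (r - m.+1%:R^-1)); last first.
  by rewrite ltrBlDr ltrDl invr_gt0.
apply/ler_addgt0Pr => e e0; have [n gn] := gP k (y - a) e0.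
by have := my n gn; rewrite /= dualB; move: (_.+1%:R^-1) => c; lra.
Qed.

(** Balls are countable combinations of half-spaces of the norming sequence by
    [norming_ball], and balls generate the Borel sets. *)
Lemma norming_generates (S : set (set F)) : sigma_algebra setT S ->
  (forall n c, S [set y | g n y <= c]) ->
  forall A : set (borel F), measurable A -> S A.
Proof.
move=> sS Sg A mA.
pose T := g_sigma_algebraType (S : set (set (pointed_tvs F))).
have mT (B : set T) : measurable B = S B by rewrite /measurable/= sigma_algebra_id.
have : measurable_fun setT (id : T -> borel F).
  apply: (measurable_into_frechet frF sepF) => k a.
  apply: (measurability _ (RGenInftyO.measurableE R)) => _ [_ [r ->] <-].
  rewrite setTI (_ : _ @^-1` _ = [set y : T | q k ((y : F) - a) < r]).
    rewrite norming_ball; apply: (@bigcupT_measurable _ T) => m.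
    by apply: (@bigcap_measurableType _ T) => n _; rewrite mT.
  by apply/seteqP; split=> y /=; rewrite in_itv.
by move=> /(_ measurableT A mA); rewrite setTI preimage_id mT.
Qed.

End generated.

End norming_sequence.

(** * Orthonormal expansions in Hilbert spaces *)

Section inner_product.
Context {R : realType} (H : hilbertType R).
Implicit Types x y z : H.

Lemma ipC x y : ip H x y = ip H y x.
Proof. by rewrite hermC/= expr0 mul1r. Qed.

Lemma ipDl x y z : ip H (x + y) z = ip H x z + ip H y z.
Proof. exact: linearDl. Qed.

Lemma ipBl x y z : ip H (x - y) z = ip H x z - ip H y z.
Proof. exact: linearBl. Qed.

Lemma ipZl a x y : ip H (a *: x) y = a * ip H x y.
Proof. exact: linearZl_LR. Qed.

Lemma ip0l x : ip H 0 x = 0.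
Proof. by rewrite -(scale0r 0) ipZl mul0r. Qed.

Lemma ip0r x : ip H x 0 = 0.
Proof. by rewrite ipC ip0l. Qed.

Lemma ipBr x y z : ip H z (x - y) = ip H z x - ip H z y.
Proof. by rewrite ipC ipBl !(ipC z). Qed.

Lemma ipZr a x y : ip H x (a *: y) = a * ip H x y.
Proof. by rewrite ipC ipZl ipC. Qed.

Lemma ip_suml (I : Type) (r : seq I) (P : pred I) (E : I -> H) y :
  ip H (\sum_(i <- r | P i) E i) y = \sum_(i <- r | P i) ip H (E i) y.
Proof.
by apply: (big_morph (ip H ^~ y)) => [u v|]; [exact: ipDl|exact: ip0l].
Qed.

Lemma ip_sumr (I : Type) (r : seq I) (P : pred I) (E : I -> H) y :
  ip H y (\sum_(i <- r | P i) E i) = \sum_(i <- r | P i) ip H y (E i).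
Proof. by rewrite ipC ip_suml; apply: eq_bigr => i _; rewrite ipC. Qed.

Lemma cauchy_schwarz x y : `|ip H x y| <= `|x| * `|y|.
Proof.
have [->|y0] := eqVneq y 0; first by rewrite ip0r !normr0 mulr0.
rewrite -(@ler_pXn2r _ 2)// ?nnegrE ?mulr_ge0// real_normK ?num_real// exprMn.
have y2 : 0 < `|y| ^+ 2 by rewrite exprn_gt0// normr_gt0.
set t := ip H x y / `|y| ^+ 2.
have : 0 <= ip H (x - t *: y) (x - t *: y) by rewrite ipE sqr_ge0.
rewrite ipBl !ipBr ipZl !ipZr ipZl !ipE (ipC y x) => h.
rewrite -ler_pdivrMr// -subr_ge0 (le_trans h)// le_eqVlt.
by apply/orP; left; apply/eqP; rewrite /t; field; rewrite ?normr_eq0.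
Qed.

Definition ip_form y (x : H) : R^o := ip H x y.

Lemma ip_form_linear y : linear (ip_form y).
Proof. by move=> a u v; rewrite /ip_form ipDl ipZl. Qed.

HB.instance Definition _ y :=
  GRing.isLinear.Build R H R^o _ (ip_form y) (ip_form_linear y).

Lemma lipschitz_linear_continuous (V : normedModType R) (f : H -> V) (M : R) :
  (forall x y, f (x - y) = f x - f y) -> (forall x, `|f x| <= M * `|x|) ->
  continuous f.
Proof.
move=> fB fM x; apply/cvgrPdist_le => e e0; near=> y.
rewrite -fB (le_trans (fM _))//.
have M0 : 0 < `|M| + 1 by rewrite ltr_wpDl.
apply: (@le_trans _ _ ((`|M| + 1) * `|x - y|)).
  by rewrite ler_wpM2r// (le_trans (ler_norm _))// lerDl.
rewrite -ler_pdivlMl//; near: y; apply: cvgr_dist_le => //.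
by rewrite mulr_gt0// invr_gt0.
Unshelve. all: by end_near. Qed.

Lemma ip_continuous y : continuous (fun x => ip H x y).
Proof.
apply: (@lipschitz_linear_continuous R^o _ `|y|) => [u v|u]; first exact: ipBl.
by rewrite mulrC; exact: cauchy_schwarz.
Qed.

Lemma cvg_ip y (u : nat -> H) x :
  u @ \oo --> x -> ip H (u n) y @[n --> \oo] --> ip H x y.
Proof.
by move=> ux; apply: (cvg_comp u (fun z => ip H z y) ux); exact: ip_continuous.
Qed.

Lemma frechet_hilbert : frechet (fun (_ : nat) x => `|x|).
Proof.
split=> //.
- by move=> _; split=> [x y|a x]; [exact: ler_normD|exact: normrZ].
- move=> x A; rewrite -nbhs_ballE; split=> [[e /= e0 eA]|[_ [e [e0 eA]]]].
    exists 0%N, e; split=> // y /= yx; apply: eA.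
    by rewrite -ball_normE/= distrC.
  by exists e => // y; rewrite -ball_normE/= distrC => yx; apply: eA.
- move=> u cu; suff : cvg (u @ \oo) by move=> ul; exists (lim (u @ \oo)).
  apply/cauchy_cvgP/cauchy_ballP => e e0.
  have [N uN] := cu 0%N e e0.
  exists (u @` [set m | (N <= m)%N] , u @` [set n | (N <= n)%N]) => /=.
    by split; exists N => // n Nn; exists n.
  by move=> _ /= [[m Nm <-] [n Nn <-]]; rewrite -ball_normE/=; exact: uN.
Qed.

Lemma continuous_form_bounded (f : {linear H -> R^o}) : continuous f ->
  exists2 M, 0 <= M & forall x, `|(f x : R)| <= M * `|x|.
Proof.
move=> cf; have /cvgrPdist_lt/(_ _ ltr01) : f x @[x --> 0] --> f 0 := cf 0.
rewrite linear0 -nbhs_ballE => -[e /= e0 ef].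
exists (2 / e); first by rewrite divr_ge0// ltW.
move=> x; have [->|x0] := eqVneq x 0; first by rewrite linear0 !normr0 mulr0.
have nx0 : 0 < `|x| by rewrite normr_gt0.
have t0 : 0 < e / 2 / `|x| by rewrite !divr_gt0.
have := ef ((e / 2 / `|x|) *: x); rewrite -ball_normE/= sub0r normrN normrZ.
rewrite (gtr0_norm t0) divfK ?gt_eqF// => /(_ (ltac:(lra))).
rewrite sub0r normrN dualZ normrM (gtr0_norm t0) -ltr_pdivlMl// mulr1.
by move=> /ltW/le_trans; apply; rewrite !invf_div mulrC.
Qed.

End inner_product.

Section orthosystem.
Context {R : realType} (H : hilbertType R).
Implicit Types (x y : H) (e : nat -> H) (c : nat -> R).

(** Vectors may vanish because Gram-Schmidt is applied to sequences that need
    not be free ; finite and infinite dimension are thus treated alike. *)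
Definition orthosystem e :=
  forall i j, ip H (e i) (e j) = ((i == j) && (e i != 0))%:R.

Definition total_system e := forall x, (forall i, ip H x (e i) = 0) -> x = 0.

Definition partial_comb e c m n : H := \sum_(m <= i < n) c i *: e i.

Section expansions.
Variable e : nat -> H.
Hypothesis oe : orthosystem e.

Lemma ip_partial_comb c m n j : ip H (partial_comb e c m n) (e j) =
  (c j * (e j != 0)%:R) *+ ((m <= j)%N && (j < n)%N).
Proof.
rewrite ip_suml; under eq_bigr do rewrite ipZl oe.
have [mjn|mjn] := boolP ((m <= j)%N && (j < n)%N); last first.
  rewrite mulr0n big_nat big1// => i mi; have [ij|] := eqVneq i j.
    by rewrite -ij mi in mjn.
  by rewrite /= mulr0.
rewrite mulr1n (bigD1_seq j) ?iota_uniq ?mem_index_iota//= eqxx/= big1 ?addr0//.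
by move=> i /negbTE ->; rewrite mulr0.
Qed.

Lemma norm_partial_comb c m n :
  `|partial_comb e c m n| ^+ 2 = \sum_(m <= i < n) c i ^+ 2 * (e i != 0)%:R.
Proof.
rewrite -ipE {2}/partial_comb ip_sumr; apply: eq_big_nat => i mi.
by rewrite ipZr ip_partial_comb mi mulr1n mulrA expr2.
Qed.

Lemma norm_partial_comb_le c m n :
  `|partial_comb e c m n| ^+ 2 <= \sum_(m <= i < n) c i ^+ 2.
Proof.
rewrite norm_partial_comb; apply: ler_sum => i _; rewrite ler_piMr ?sqr_ge0//.
by case: (_ != _).
Qed.

Lemma partial_combB c m n : (m <= n)%N ->
  partial_comb e c 0 n - partial_comb e c 0 m = partial_comb e c m n.
Proof.
by move=> mn; rewrite /partial_comb (@big_cat_nat _ _ _ m 0 n)//= addrAC subrr add0r.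
Qed.

Lemma riesz_fischer c M : (forall n, \sum_(0 <= i < n) c i ^+ 2 <= M) ->
  exists2 x, partial_comb e c 0 @ \oo --> x &
             forall j, ip H x (e j) = c j * (e j != 0)%:R.
Proof.
move=> cM; suff [x cx] : exists x, partial_comb e c 0 @ \oo --> x.
  exists x => // j; apply/esym/(@cvg_unique _ (@Rhausdorff R)
    (ip H (partial_comb e c 0 n) (e j) @[n --> \oo])); last first.
    exact: cvg_ip cx.
  apply: cvg_near_cst; exists j.+1 => // n /= jn.
  by rewrite ip_partial_comb jn mulr1n.
suff : frechet_cauchy (q := fun (_ : nat) (x : H) => `|x|) (partial_comb e c 0).
  exact: (frechet_complete (frechet_hilbert H)).
move=> _ r r0.
pose S := series (fun i => c i ^+ 2).
have cS : cvgn S.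
  apply: nondecreasing_is_cvgn.
    by apply: nondecreasing_series => i _; rewrite sqr_ge0.
  by exists M => _ [n _ <-]; exact: cM.
have r20 : 0 < r ^+ 2 by rewrite exprn_gt0.
have fR := frechet_hilbert H.
have /cvgrPdist_lt/(_ _ (divr_gt0 r20 (ltr0n _ 2)))[N _ NS] := cS.
have key m n : (N <= m)%N -> (m <= n)%N ->
    `|partial_comb e c 0 m - partial_comb e c 0 n| < r.
  move=> Nm mn; rewrite distrC partial_combB//.
  rewrite -(@ltr_pXn2r _ 2)// ?nnegrE ?(ltW r0)//.
  rewrite (le_lt_trans (norm_partial_comb_le _ _ _))//.
  have -> : \sum_(m <= i < n) c i ^+ 2 = S n - S m.
    by rewrite /S /series/= (@big_cat_nat _ _ _ m 0 n)//= addrAC subrr add0r.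
  have := NS _ Nm; have := NS _ (leq_trans Nm mn) => /=.
  by rewrite !ltr_norml; lra.
exists N => m n Nm Nn; have [/key-> //|/ltnW/key nm] := leqP m n.
by rewrite distrC nm.
Qed.

Definition proj x n := partial_comb e (fun i => ip H x (e i)) 0 n.

Lemma ip_null x i : ip H x (e i) * (e i != 0)%:R = ip H x (e i).
Proof. by have [->|] := eqVneq (e i) 0; rewrite ?mulr1// ip0r mul0r. Qed.

Lemma norm_proj x n : `|proj x n| ^+ 2 = \sum_(0 <= i < n) ip H x (e i) ^+ 2.
Proof.
rewrite norm_partial_comb; apply: eq_bigr => i _.
by rewrite expr2 -mulrA ip_null.
Qed.

Lemma ip_proj_self x n : ip H x (proj x n) = `|proj x n| ^+ 2.
Proof.
rewrite norm_proj ip_sumr; apply: eq_bigr => i _.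
by rewrite ipZr expr2.
Qed.

Lemma bessel x n : \sum_(0 <= i < n) ip H x (e i) ^+ 2 <= `|x| ^+ 2.
Proof.
rewrite -norm_proj; have := sqr_ge0 `|x - proj x n|.
rewrite -[`|x - _| ^+ 2]ipE ipBl !ipBr (ipC (proj x n) x) !ipE ip_proj_self; lra.
Qed.

Lemma norm_proj_le x n : `|proj x n| <= `|x|.
Proof.
by rewrite -(@ler_pXn2r _ 2)// ?nnegrE// norm_proj bessel.
Qed.

Lemma proj_linear n : linear (proj ^~ n).
Proof.
move=> a x y; rewrite /proj /partial_comb scaler_sumr -big_split/=.
by apply: eq_bigr => i _; rewrite ipDl ipZl scalerDl scalerA.
Qed.

Lemma ip_proj x y n : ip H (proj x n) y = ip H x (proj y n).
Proof.
rewrite ip_suml ip_sumr; apply: eq_bigr => i _.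
by rewrite ipZl ipZr mulrC (ipC y).
Qed.

Lemma ip_proj_basis x n i : (i < n)%N -> ip H (proj x n) (e i) = ip H x (e i).
Proof. by move=> ni; rewrite ip_partial_comb ni mulr1n ip_null. Qed.

Lemma proj_proj x m n : (m <= n)%N -> proj (proj x n) m = proj x m.
Proof.
move=> mn; apply: eq_big_nat => i /andP[_ im].
by rewrite ip_proj_basis// (leq_trans im).
Qed.

Lemma proj_basis i n : proj (e i) n = if (i < n)%N then e i else 0.
Proof.
rewrite /proj /partial_comb; case: ltnP => [ni|ni].
  rewrite (bigD1_seq i) ?iota_uniq ?mem_index_iota//= oe eqxx/= big1 ?addr0.
    by have [->|] := eqVneq (e i) 0; rewrite ?scaler0// scale1r.
  by move=> j /negbTE ji; rewrite oe eq_sym ji scale0r.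
rewrite big_nat_cond big1// => j /andP[/andP[_ jn] _].
by rewrite oe gtn_eqF ?scale0r// (leq_trans jn).
Qed.

(** The reflection that fixes the first [n] vectors of the system and reverses
    the orthogonal directions. *)
Definition flip n x : H := 2 *: proj x n - x.

Lemma flip_linear n : linear (flip n).
Proof.
move=> a x y; rewrite /flip proj_linear !scalerDr !scalerA opprD addrACA.
by rewrite (mulrC 2) scalerN.
Qed.

Lemma flip_continuous n : continuous (flip n).
Proof.
apply: (@lipschitz_linear_continuous _ _ _ _ 3) => [x y|x].
  by rewrite addrC -scaleN1r flip_linear scaleN1r addrC.
rewrite (le_trans (ler_normB _ _))// normrZ ger0_norm//.
have := norm_proj_le x n; lra.
Qed.

Lemma flip_basis n i : flip n (e i) = (if (i < n)%N then 1 else -1) *: e i.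
Proof.
rewrite /flip proj_basis; case: ifP => _; last by rewrite scaler0 sub0r scaleN1r.
by rewrite scale1r scaler_nat mulr2n addrK.
Qed.

Hypothesis te : total_system e.

Lemma total_eq x y : (forall i, ip H x (e i) = ip H y (e i)) -> x = y.
Proof.
move=> xy; apply/eqP; rewrite -subr_eq0; apply/eqP/te => i.
by rewrite ipBl xy subrr.
Qed.

Lemma cvg_proj x : proj x @ \oo --> x.
Proof.
have [y cy yE] := riesz_fischer (bessel x).
suff xy : x = y by rewrite {2}xy.
by apply: total_eq => i; rewrite yE ip_null.
Qed.

Lemma cvg_norm_proj x : `|proj x n| @[n --> \oo] --> `|x|.
Proof. by apply: cvg_norm; exact: cvg_proj. Qed.

End expansions.

(** The last clause says that [e n] lies in the span of [h], in the form in which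
    it is used : [e n] has every linear property that all the [h n] have. *)
Lemma gram_schmidt (h : nat -> H) : exists e, [/\ orthosystem e,
  forall n, h n = proj e (h n) n.+1 &
  forall Q : H -> Prop, (forall a x y, Q x -> Q y -> Q (a *: x + y)) ->
    Q 0 -> (forall n, Q (h n)) -> forall n, Q (e n)].
Proof.
pose resid n s := h n - \sum_(v <- s) ip H (h n) v *: v.
pose nrm x : H := `|x|^-1 *: x.
pose es := fix es n := if n is m.+1 then rcons (es m) (nrm (resid m (es m)))
                       else [::].
pose e n := nth 0 (es n.+1) n.
have sz n : size (es n) = n by elim: n => //= n IH; rewrite size_rcons IH.
have esE n : es n = [seq e i | i <- index_iota 0 n].
  rewrite /index_iota subn0; elim: n => // n IH.
  rewrite -[in RHS]addn1 iotaD map_cat add0n [map _ (iota n 1)]/=.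
  by rewrite {2}/e [es n.+1]/= nth_rcons sz ltnn eqxx -IH cats1.
have eE n : e n = nrm (h n - proj e (h n) n).
  by rewrite {1}/e/= nth_rcons sz ltnn eqxx /resid esE big_map.
have oe_lt n : forall i j, (i < n)%N -> (j < n)%N ->
    ip H (e i) (e j) = ((i == j) && (e i != 0))%:R.
  elim: n => // n IH.
  have en_diag : ip H (e n) (e n) = (e n != 0)%:R.
    rewrite eE; set v := (_ - _); have [v0|v0] := eqVneq v 0.
      by rewrite /nrm v0 scaler0 eqxx ip0l.
    rewrite /nrm scaler_eq0 invr_eq0 normr_eq0 (negbTE v0)/= ipZl ipZr ipE.
    by rewrite mulrA -expr2 -exprMn mulVf ?expr1n// normr_eq0.
  have en_low j : (j < n)%N -> ip H (e n) (e j) = 0.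
    move=> jn; rewrite eE /nrm ipZl ipBl ip_suml.
    rewrite (_ : \sum_(_ <= _ < _) _ = ip H (h n) (e j)) ?subrr ?mulr0//.
    under eq_big_nat => i ni do rewrite ipZl IH//.
    rewrite (bigD1_seq j) ?iota_uniq ?mem_index_iota//= eqxx/= big1 ?addr0.
      by have [->|] := eqVneq (e j) 0; rewrite ?mulr1// ip0r mul0r.
    by move=> i /negbTE ->; rewrite mulr0.
  move=> i j; rewrite ltnS leq_eqVlt => ni; rewrite ltnS leq_eqVlt => nj.
  move: ni nj => /predU1P[->|ni] /predU1P[->|nj].
  - by rewrite eqxx.
  - by rewrite en_low// eq_sym (ltn_eqF nj).
  - by rewrite ipC en_low// (ltn_eqF ni).
  - exact: IH.
have oe : orthosystem e.
  by move=> i j; apply: (oe_lt (maxn i j).+1); rewrite ltnS ?leq_maxl ?leq_maxr.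
exists e; split=> // [n|Q QD Q0 Qh n].
  rewrite /proj /partial_comb big_nat_recr//=.
  rewrite -/(partial_comb _ _ _ _) -/(proj e (h n) n).
  set p := proj e (h n) n; have [v0|v0] := eqVneq (h n - p) 0.
    have -> : e n = 0 by rewrite eE v0 /nrm scaler0.
    by rewrite scaler0 addr0; apply/eqP; rewrite -subr_eq0 v0.
  have ep : ip H p (e n) = 0 by rewrite ip_partial_comb// ltnn andbF mulr0n.
  have -> : ip H (h n) (e n) = `|h n - p|.
    rewrite -[h n](subrK p) ipDl ep addr0 eE /nrm ipZr ipE subrK.
    by rewrite expr2 mulrA mulVf ?mul1r// normr_eq0.
  by rewrite eE /nrm scalerA mulfV ?normr_eq0// scale1r addrC subrK.
elim/ltn_ind: n => n IH.
have QZ a x : Q x -> Q (a *: x) by move=> Qx; rewrite -[a *: x]addr0; exact: QD.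
have QA x y : Q x -> Q y -> Q (x + y) by move=> Qx; rewrite -[x]scale1r; exact: QD.
rewrite eE; apply: (QZ); apply: (QA) => //; rewrite -scaleN1r; apply: (QZ).
rewrite /proj /partial_comb big_nat_cond.
by apply: big_ind => // i /andP[/andP[_ ni] _]; apply: (QZ); exact: IH.
Qed.

(** Orthonormalize a dense sequence: a vector that is orthogonal to it is
    arbitrarily close to vectors that are orthogonal to it. *)
Lemma total_orthosystem : Defs.separable H ->
  exists e : nat -> H, orthosystem e /\ total_system e.
Proof.
move=> sH; have [d dd] := frechet_dense_sequence (frechet_hilbert H) sH.
have [e [oe dE _]] := gram_schmidt d; exists e; split=> // x xe.
have xd n : ip H x (d n) = 0.
  rewrite dE ip_sumr big1// => i _.
  by rewrite ipZr xe mulr0.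
apply/eqP; rewrite -normr_le0 leNgt; apply/negP => x0.
have [n] := dd x 0%N `|x| x0; rewrite -(ltr_pM2l x0) ltNge => /negP; apply.
rewrite -expr2 -ipE -[ip H x x]subr0 -(xd n) -ipBr.
by rewrite (le_trans (ler_norm _))// cauchy_schwarz.
Qed.

(** The coefficients [f (e i)] are square-summable because [f] is bounded : the
    sum [S] of the first [n] squares satisfies [S <= M * sqrt S]. *)
Lemma riesz (f : {linear H -> R^o}) : Defs.separable H -> continuous f ->
  exists w, forall x, f x = ip H w x.
Proof.
move=> sH cf; have [e [oe te]] := total_orthosystem sH.
have [M M0 fM] := continuous_form_bounded cf.
pose c i : R := f (e i).
have fcomb d n : f (partial_comb e d 0 n) = \sum_(0 <= i < n) d i * c i :> R.
  by rewrite dual_sum; apply: eq_bigr => i _; rewrite dualZ.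
have [n|w _ wE] := @riesz_fischer e oe c (M ^+ 2).
  set S := \sum_(_ <= _ < _) _.
  have S0 : 0 <= S by apply: sumr_ge0 => i _; rewrite sqr_ge0.
  have SM : S <= M * Num.sqrt S.
    have fS : f (partial_comb e c 0 n) = S :> R.
      by rewrite fcomb; apply: eq_bigr => i _; rewrite expr2.
    rewrite -{1}fS (le_trans (ler_norm _))// (le_trans (fM _))// ler_wpM2l//.
    rewrite -(@ler_pXn2r _ 2)// ?nnegrE ?sqrtr_ge0// sqr_sqrtr//.
    exact: norm_partial_comb_le.
  have [S00|Sn0] := eqVneq S 0; first by rewrite S00 sqr_ge0.
  have s0 : 0 < Num.sqrt S by rewrite sqrtr_gt0 lt_neqAle eq_sym Sn0.
  rewrite -[S]sqr_sqrtr// ler_pXn2r ?nnegrE ?sqrtr_ge0//.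
  by rewrite -(ler_pM2r s0) -expr2 sqr_sqrtr.
exists w => x.
have fp n : f (proj e x n) = ip H (proj e x n) w :> R.
  rewrite fcomb ip_suml; apply: eq_bigr => i _; rewrite ipZl (ipC (e i)) wE /c.
  by have [->|] := eqVneq (e i) 0; rewrite ?mulr1// ip0r !mul0r.
rewrite ipC.
apply: (@cvg_unique _ (@Rhausdorff R) (ip H (proj e x n) w @[n --> \oo])).
  have <- : (fun n => f (proj e x n) : R) = (fun n => ip H (proj e x n) w).
    exact/funext.
  apply: (@cvg_comp _ _ _ (proj e x) f); first exact: (cvg_proj oe te).
  exact: cf.
by apply: cvg_ip; exact: (cvg_proj oe te).
Qed.

End orthosystem.

(** * Almost sure events and laws of limits *)

Section probability_facts.
Context d (T : measurableType d) {R : realType} (P : probability T R).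
Implicit Types A B : set T.
Local Open Scope ereal_scope.

Lemma measurable_preimage d' (T' : measurableType d') (f : T -> T') (B : set T') :
  measurable_fun setT f -> measurable B -> measurable (f @^-1` B).
Proof. by move=> mf mB; rewrite -[X in measurable X]setTI; exact: mf. Qed.

Lemma full_setI D A : measurable D -> P D = 1 -> measurable A -> P (D `&` A) = P A.
Proof.
move=> mD PD mA; rewrite -[in RHS](setIT A) -(setUv D) setIUr measureU.
- rewrite [X in _ = _ + X](_ : _ = 0) ?adde0 1?setIC//.
  apply: (subset_measure0 (B := ~` D)).
  + by apply: measurableI => //; exact: measurableC.
  + exact: measurableC.
  + exact: subIsetl.
  + by have := probability_setC P mD; rewrite PD subee.
- exact: measurableI.
- by apply: measurableI => //; exact: measurableC.
- by rewrite setIACA setICr setI0.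
Qed.

Lemma borel_cantelli (B : nat -> set T) G :
  (forall n, measurable (B n)) -> (forall n, P (B n) <= (1 / (2 ^ n.+1)%:R)%:E) ->
  measurable G -> (forall t, (exists N, forall n, (N <= n)%N -> ~ B n t) -> G t) ->
  P G = 1.
Proof.
move=> mB PB mG GB; have B0 : P (lim_sup_set B) = 0.
  apply: lim_sup_set_cvg0 => //; apply: (@le_lt_trans _ _ 1); last exact: ltry.
  apply: le_trans (epsilon_trick0 xpredT (@ler01 R)).
  by apply: lee_nneseries => [i _ _|n _]; [exact: measure_ge0|exact: PB].
rewrite -[G]setCK probability_setC; last exact: measurableC.
rewrite (subset_measure0 _ _ _ B0) ?sube0//.
- exact: measurableC.
- by apply: bigcap_measurable => // n _; exact: bigcup_measurable.
- move=> t Gt n _; apply: contrapT => nB; apply: Gt; apply: GB; exists n => m nm Bm.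
  by apply: nB; exists m.
Qed.

Lemma tail_small (f : T -> R) (e : R) : measurable_fun setT f -> (0 < e)%R ->
  exists2 M : R, (0 < M)%R & P [set t | (M <= `|f t|)%R] <= e%:E.
Proof.
move=> mf e0; pose A n := [set t | (n%:R <= `|f t|)%R].
have mA n : measurable (A n).
  rewrite (_ : A n = (fun t => `|f t|%R) @^-1` `[n%:R, +oo[).
    by apply: measurable_preimage => //; exact: measurableT_comp.
  by apply/seteqP; split=> t /=; rewrite in_itv/= andbT.
have A0 : \bigcap_n A n = set0.
  apply/seteqP; split=> // t At.
  have := At (Num.Def.truncn `|f t|).+1 I; rewrite /A/= leNgt => /negP; apply.
  by rewrite truncnS_gt.
have : (P \o A) @ \oo --> P (\bigcap_n A n).
  apply: nonincreasing_cvg_mu => //.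
  - by rewrite (le_lt_trans (probability_le1 P _))// ltry.
  - by rewrite A0.
  - move=> m n mn; apply/subsetPset => t; rewrite /A/=; apply: le_trans.
    by rewrite ler_nat.
rewrite A0 measure0 => /fine_cvgP[fA /cvgrPdist_le/(_ _ e0) cA].
near \oo => n; exists (n.+1%:R) => //.
have -> : [set t | (n.+1%:R <= `|f t|)%R] = A n.+1 by [].
apply: (@le_trans _ _ (P (A n))).
  apply: le_measure; rewrite ?inE//.
  by move=> t; rewrite /A/=; apply: le_trans; rewrite ler_nat.
rewrite -[P _]fineK ?lee_fin; last by near: n.
have : (`|0 - fine (P (A n))| <= e)%R by near: n.
by rewrite sub0r normrN; apply: le_trans; exact: ler_norm.
Unshelve. all: by end_near. Qed.

End probability_facts.

Section law.
Context d d' (T : measurableType d) (T' : measurableType d') {R : realType}.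
Variables (P : probability T R) (f : T -> T').
Hypothesis mf : measurable_fun setT f.

Definition law : probability T' R :=
  let mfun_f : {mfun T >-> T'} := HB.pack f (isMeasurableFun.Build _ _ _ _ f mf) in
  distribution P mfun_f.

Lemma lawE A : law A = P (f @^-1` A).
Proof. by []. Qed.

Lemma ge0_integral_law (g : T' -> \bar R) :
  measurable_fun setT g -> (forall y, (0 <= g y)%E) ->
  (\int[law]_y g y = \int[P]_x g (f x))%E.
Proof. exact: ge0_integral_distribution. Qed.

End law.

Section rays.
Context {R : realType}.

Lemma measure_eq_rays (m1 m2 : {measure set (measurableTypeR R) -> \bar R}) :
  (forall a : R, m1 `]a, +oo[%classic = m2 `]a, +oo[%classic) ->
  (forall a : R, (m1 `]a, +oo[%classic < +oo)%E) ->
  forall A, measurable A -> m1 A = m2 A.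
Proof.
move=> m12 m1oo A mA; apply: (@measure_unique _ R (measurableTypeR R) (@RGenOInfty.G R)
  (fun n : nat => `](- n%:R), +oo[%classic)) => //.
- exact: RGenOInfty.measurableE.
- move=> _ _ [a ->] [b ->]; exists (Num.max a b).
  by apply/seteqP; split=> x /=; rewrite !in_itv/= !andbT gt_max => /andP.
- by move=> n; exists (- n%:R).
- apply/seteqP; split=> // x _; exists (Num.Def.truncn `|x|).+1 => //=.
  rewrite in_itv/= andbT ltrNl (le_lt_trans _ (truncnS_gt _))//.
  by rewrite -normrN ler_norm.
- by move=> _ [a ->].
Qed.

End rays.

Section law_of_limit.
Context {R : realType}.
Local Open Scope ereal_scope.

(** For [a < b], the limit exceeds [b] only if all but finitely many terms do, and
    infinitely many terms exceed [b] only if the limit exceeds [a]. *)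
Lemma limit_ray_le d1 d2 (T1 : measurableType d1) (T2 : measurableType d2)
    (P : probability T1 R) (Q : probability T2 R)
    (Z : nat -> T1 -> R) (z : T1 -> R) (W : nat -> T2 -> R) (w : T2 -> R)
    (D : set T1) (C : set T2) :
  (forall n, measurable_fun setT (Z n)) -> measurable_fun setT z ->
  (forall n, measurable_fun setT (W n)) -> measurable_fun setT w ->
  measurable D -> P D = 1 -> measurable C -> Q C = 1 ->
  (forall t, D t -> Z^~ t @ \oo --> z t) -> (forall t, C t -> W^~ t @ \oo --> w t) ->
  (forall n a, P (Z n @^-1` `]a, +oo[) = Q (W n @^-1` `]a, +oo[)) ->
  forall a, P (z @^-1` `]a, +oo[) <= Q (w @^-1` `]a, +oo[).
Proof.
move=> mZ mz mW mw mD PD mC QC Zz Ww PQ a.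
have mpre d (T : measurableType d) (f : T -> R) b :
    measurable_fun setT f -> measurable (f @^-1` `]b, +oo[).
  by move=> mf; exact: measurable_preimage.
have step b : (a < b)%R -> P (z @^-1` `]b, +oo[) <= Q (w @^-1` `]a, +oo[).
  move=> ab.
  pose A n := D `&` \bigcap_(k in [set k | (n <= k)%N]) (Z k @^-1` `]b, +oo[).
  pose B n := C `&` \bigcup_(k in [set k | (n <= k)%N]) (W k @^-1` `]b, +oo[).
  have mA n : measurable (A n).
    by apply: measurableI => //; apply: bigcap_measurableType => k _; exact: mpre.
  have mB n : measurable (B n).
    by apply: measurableI => //; apply: bigcup_measurable => k _; exact: mpre.
  have cA : (P \o A) @ \oo --> P (\bigcup_n A n).
    apply: nondecreasing_cvg_mu => //; first exact: bigcupT_measurable.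
    move=> m n mn; apply/subsetPset => t [Dt At]; split=> // k nk.
    by apply: At; exact: leq_trans nk.
  have cB : (Q \o B) @ \oo --> Q (\bigcap_n B n).
    apply: nonincreasing_cvg_mu => //; last 2 first.
    - exact: bigcapT_measurable.
    - move=> m n mn; apply/subsetPset => t [Ct [k nk Bk]]; split=> //.
      by exists k => //; exact: leq_trans nk.
    by rewrite (le_lt_trans (probability_le1 Q _))// ltry.
  apply: (@le_trans _ _ (P (\bigcup_n A n))).
    rewrite -(full_setI mD PD (mpre _ _ _ b mz)); apply: le_measure; rewrite ?inE.
    - by apply: measurableI => //; exact: mpre.
    - exact: bigcupT_measurable.
    move=> t [Dt]; rewrite /preimage/= in_itv/= andbT => bz.
    have /cvgrPdist_lt/(_ (z t - b)%R) := Zz t Dt; rewrite subr_gt0 => /(_ bz)[N _ NZ].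
    exists N => //; split=> // k /NZ; rewrite /preimage/= in_itv/= andbT.
    by rewrite ltr_norml => /andP[_]; lra.
  apply: (@le_trans _ _ (Q (\bigcap_n B n))).
    apply: lee_cvg_to cA cB _; apply: nearW => n /=.
    apply: (@le_trans _ _ (P (Z n @^-1` `]b, +oo[))).
      apply: le_measure; rewrite ?inE//; first exact: mpre.
      by move=> t [_ At]; apply: At => /=.
    rewrite PQ -(full_setI mC QC (mpre _ _ _ b (mW n))).
    apply: le_measure; rewrite ?inE//.
      by apply: measurableI => //; exact: mpre.
    by move=> t [Ct Bt]; split=> //; exists n => /=.
  apply: le_measure; rewrite ?inE//; [exact: bigcapT_measurable|exact: mpre|].
  move=> t Bt; rewrite /preimage/= in_itv/= andbT ltNge; apply/negP => wa.
  have Ct : C t by case: (Bt 0%N I).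
  have /cvgrPdist_lt/(_ (b - a)%R) := Ww t Ct; rewrite subr_gt0 => /(_ ab)[N _ NW].
  have [_ [k /= Nk]] := Bt N I; rewrite /preimage/= in_itv/= andbT => bW.
  by have := NW k Nk; rewrite ltr_norml => /andP[+ _]; lra.
pose E n := z @^-1` `](a + n.+1%:R^-1)%R, +oo[.
have : (P \o E) @ \oo --> P (\bigcup_n E n).
  apply: nondecreasing_cvg_mu.
  - by move=> n; exact: mpre.
  - by apply: bigcupT_measurable => n; exact: mpre.
  - move=> m n mn; apply/subsetPset => t; rewrite /E /preimage/= !in_itv/= !andbT.
    by apply: le_lt_trans; rewrite lerD2l lef_pV2 ?posrE// ler_nat.
have -> : \bigcup_n E n = z @^-1` `]a, +oo[.
  apply/seteqP; split=> t; rewrite /E /preimage/= in_itv/= andbT.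
    by move=> [n _] /=; rewrite in_itv/= andbT; apply: lt_trans; rewrite ltrDl invr_gt0.
  by move=> /ltr_add_invr[n an]; exists n => //=; rewrite in_itv/= andbT.
move=> cE; rewrite -(cvg_lim _ cE)//; apply: lime_le.
  by apply/cvg_ex; eexists; exact: cE.
by apply: nearW => n /=; apply: step; rewrite ltrDl invr_gt0.
Qed.

(** Limits of sequences with the same laws have the same law: [limit_ray_le] is
    symmetric in the two sequences, and rays determine a law. *)
Lemma law_of_limit d1 d2 (T1 : measurableType d1) (T2 : measurableType d2)
    (P : probability T1 R) (Q : probability T2 R)
    (Z : nat -> T1 -> R) (z : T1 -> R) (W : nat -> T2 -> R) (w : T2 -> R)
    (D : set T1) (C : set T2) :
  (forall n, measurable_fun setT (Z n)) -> measurable_fun setT z ->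
  (forall n, measurable_fun setT (W n)) -> measurable_fun setT w ->
  measurable D -> P D = 1 -> measurable C -> Q C = 1 ->
  (forall t, D t -> Z^~ t @ \oo --> z t) -> (forall t, C t -> W^~ t @ \oo --> w t) ->
  (forall n a, P (Z n @^-1` `]a, +oo[) = Q (W n @^-1` `]a, +oo[)) ->
  forall B : set (measurableTypeR R), measurable B -> P (z @^-1` B) = Q (w @^-1` B).
Proof.
move=> mZ mz mW mw mD PD mC QC Zz Ww PQ.
move=> B mB.
pose mz' : measurable_fun setT (z : T1 -> measurableTypeR R) := mz.
pose mw' : measurable_fun setT (w : T2 -> measurableTypeR R) := mw.
rewrite -(lawE P mz') -(lawE Q mw').
apply: (@measure_eq_rays _ (law P mz') (law Q mw')) => // a.
  apply/eqP; rewrite eq_le; apply/andP; split.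
    exact: (limit_ray_le mZ mz mW mw mD PD mC QC).
  exact: (limit_ray_le mW mw mZ mz mC QC mD PD).
by rewrite (le_lt_trans (probability_le1 P _))// ?ltry//; exact: measurable_preimage.
Qed.

End law_of_limit.

(** * Centered normal laws *)

Section normal.
Context {R : realType}.
Notation mu := (@lebesgue_measure R).

Lemma measurable_scale (s : R) :
  measurable_fun setT (fun x : measurableTypeR R => s * x : measurableTypeR R).
Proof. by apply: measurable_funM. Qed.

Lemma derive1_scale (s : R) : (fun x : R => s * x)^`()%classic = cst s.
Proof.
apply/funext => x; rewrite derive1E deriveM// derive_id derive_cst scaler0 addr0.
by rewrite -[LHS]/(s *: 1) scaler1.
Qed.

Lemma normal_prob_scale (s : R) (B : set (measurableTypeR R)) : 0 < s -> measurable B ->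
  normal_prob 0 s B = normal_prob 0 1 [set x : R | B (s * x)].
Proof.
move=> s0 mB.
apply: (@measure_eq_rays _ (normal_prob 0 s)
  (law (normal_prob 0 1) (measurable_scale s))) => // a; last first.
  by rewrite (le_lt_trans (probability_le1 _ _))// ?ltry.
rewrite /= /distribution /pushforward.
have -> : (fun x : R => s * x) @^-1` `]a, +oo[ = `](a / s), +oo[%classic.
  by apply/seteqP; split=> x /=; rewrite !in_itv/= !andbT ltr_pdivrMr// mulrC.
rewrite /normal_prob !integral_itv_obnd_cbnd; last 2 first.
  by apply/measurable_EFinP/measurable_funTS; exact: measurable_normal_pdf.
  by apply/measurable_EFinP/measurable_funTS; exact: measurable_normal_pdf.
have aE : a = s * (a / s) by rewrite mulrC divfK// gt_eqF.
rewrite {1}aE (@increasing_ge0_integration_by_substitutiony _ (fun x => s * x))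
  ?derive1_scale.
- apply: eq_integral => x _; rewrite !fctE; congr (_%:E).
  rewrite !normal_pdfE ?oner_eq0 ?gt_eqF// /normal_fun /normal_peak !subr0 expr1n.
  rewrite mulrAC; congr (_ * expR _).
    rewrite -mulrnAr mul1r sqrtrM ?sqr_ge0// sqrtr_sqr gtr0_norm// invfM.
    by rewrite mulrC mulrA mulfV ?mul1r// gt_eqF.
  by field; rewrite gt_eqF.
- by move=> x y _ _ xy; rewrite ltr_pM2l.
- by move=> x _; exact: cvg_cst.
- exact: is_cvg_cst.
- exact: is_cvg_cst.
- split; first by move=> x _; exact: derivableM.
  by apply: cvgM; [exact: cvg_cst|exact: cvg_at_right_filter].
- by under eq_fun do rewrite mulrC; apply: gt0_cvgMly => //; exact: cvg_id.
- by apply: continuous_subspaceT; apply: continuous_normal_pdf; rewrite gt_eqF.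
- by move=> x _; exact: normal_pdf_ge0.
Qed.

Local Open Scope ereal_scope.

(** The density is a Radon-Nikodym derivative, for which the change of variables
    is known. *)
Lemma ge0_integral_normal_prob (m s : R) (f : R -> \bar R) :
  (forall x, 0 <= f x) -> measurable_fun setT f ->
  \int[normal_prob m s]_x f x = \int[mu]_x (f x * (normal_pdf m s x)%:E).
Proof.
move=> f0 mf; have dom := normal_prob_dominates m s.
pose g := Radon_Nikodym_SigmaFinite.f (normal_prob m s) mu.
have ig : mu.-integrable setT g by exact: Radon_Nikodym_SigmaFinite.f_integrable.
have mpdf : measurable_fun setT (fun x => (normal_pdf m s x)%:E).
  by apply/measurable_EFinP; exact: measurable_normal_pdf.
rewrite -(Radon_Nikodym_SigmaFinite.change_of_variables dom f0 measurableT mf).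
apply: ae_eq_integral => //.
- by apply: emeasurable_funM => //; exact: measurable_int ig.
- exact: emeasurable_funM.
- apply: ae_eqe_mul2l; apply: integral_ae_eq => // E _ mE.
  by rewrite -Radon_Nikodym_SigmaFinite.f_integral.
Qed.

Lemma cvg_mul_gauss : (n%:R * gauss_fun (n%:R : R))%R @[n --> \oo] --> (0 : R)%R.
Proof.
apply: (@squeeze_cvgr _ _ _ _ (cst 0%R) (fun n => n.+1%:R^-1 *+ 2 : R)%R).
- near=> n; have n0 : (0 < n)%N by near: n; exact: nbhs_infty_gt.
  rewrite mulr_ge0 ?gauss_fun_ge0//= /gauss_fun expRN.
  rewrite ler_pdivrMr ?expR_gt0//.
  apply: (@le_trans _ _ ((n.+1%:R^-1 *+ 2) * (1 + n%:R ^+ 2))%R); last first.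
    by rewrite ler_pM2l ?expR_ge1Dx// mulrn_wgt0.
  rewrite -[(_ *+ 2)%R]mulr_natl mulrAC ler_pdivlMr ?ltr0n// -natr1.
  have : (1 <= n%:R :> R)%R by rewrite ler1n.
  by move: (n%:R : R)%R => x; nra.
- exact: cvg_cst.
- rewrite -(mul0rn _ 2); apply: cvgMn; exact: cvg_harmonic.
Unshelve. all: by end_near. Qed.

Let sqr_gauss (x : R) : R := (x ^+ 2 * gauss_fun x)%R.

Let cont_sqr_gauss : continuous sqr_gauss.
Proof.
by move=> x; apply: cvgM; [exact: exprn_continuous|exact: continuous_gauss_fun].
Qed.

Let sqr_gauss_ge0 x : (0 <= sqr_gauss x)%R.
Proof. by rewrite mulr_ge0 ?sqr_ge0 ?gauss_fun_ge0. Qed.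

Let gauss_primitive (x : R) : R := (x * gauss_fun x)%R.

Let is_derive_gauss_primitive (x : R^o) :
  is_derive x (1 : R^o)%R (gauss_primitive : R^o -> R^o)
    (gauss_fun x - 2 * sqr_gauss x)%R.
Proof.
have h1 : is_derive x (1 : R^o)%R (@gauss_fun R : R^o -> R^o)
    (- (2 * x * gauss_fun x))%R.
  have h0 : is_derive x (1 : R^o)%R (fun y : R^o => - y ^+ 2 : R^o)%R (- (2 * x))%R.
    by apply: is_derive_eq; rewrite /GRing.scale/= mulr1 [in RHS]mulr_natl mulr2n.
  have h : is_derive x (1 : R^o)%R (expR \o (fun y : R => - y ^+ 2)%R) _ :=
    is_derive1_comp (is_derive_expR _) h0.
  by apply: (is_derive_eq h); rewrite mulrN mulrC.
have h : is_derive x (1 : R^o)%R ((id : R -> R) * @gauss_fun R)%R _ :=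
  is_deriveM (is_derive_id _ _) h1.
apply: (is_derive_eq h).
by rewrite /sqr_gauss /GRing.scale/=; ring.
Qed.

(** The derivative of [x * gauss_fun x] is [gauss_fun x - 2 * sqr_gauss x]. *)
Let integral_sqr_gauss_itv (n : nat) :
  \int[mu]_(x in `[0%R, n%:R]) (gauss_fun x)%:E =
  (n%:R * gauss_fun (n%:R : R))%:E +
  2%:E * \int[mu]_(x in `[0%R, n%:R]) (sqr_gauss x)%:E.
Proof.
case: n => [|n].
  by rewrite set_itv1 !integral_set1 mul0r add0e mule0.
pose f x : R := (gauss_fun x - 2 * sqr_gauss x)%R.
have cf : continuous f.
  move=> x; apply: cvgB; first exact: continuous_gauss_fun.
  by apply: cvgM; [exact: cvg_cst|exact: cont_sqr_gauss].
have int (h : R -> R) : continuous h -> mu.-integrable `[0%R, n.+1%:R] (EFin \o h).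
  move=> ch; apply: continuous_compact_integrable; first exact: segment_compact.
  exact: continuous_subspaceT.
have <- : \int[mu]_(x in `[0%R, n.+1%:R]) (f x)%:E =
    (n.+1%:R * gauss_fun (n.+1%:R : R))%:E.
  rewrite (@continuous_FTC2 _ _ gauss_primitive) ?ltr0n//.
  - by rewrite /gauss_primitive mul0r sube0.
  - exact: continuous_subspaceT.
  - have cF : continuous gauss_primitive.
      by move=> x; apply: cvgM; [exact: cvg_id|exact: continuous_gauss_fun].
    split; first by move=> x _; have [] := is_derive_gauss_primitive x.
    + by apply: cvg_at_right_filter; exact: cF.
    + by apply: cvg_at_left_filter; exact: cF.
  - by move=> x _; rewrite derive1E; have [_ ->] := is_derive_gauss_primitive x.
rewrite -integralZl//; last exact: int.
rewrite -integralD//; [|exact: int|].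
  by apply: eq_integral => x _; rewrite /= -EFinM -EFinD /f subrK.
apply: (int (fun x => 2 * sqr_gauss x)%R) => x.
by apply: cvgM; [exact: cvg_cst|exact: cont_sqr_gauss].
Qed.

Lemma integral0y_sqr_gauss :
  \int[mu]_(x in `[0%R, +oo[) (sqr_gauss x)%:E = (Num.sqrt pi / 4)%:E.
Proof.
have mg := @measurable_gauss_fun R.
have msg : measurable_fun setT sqr_gauss by exact: continuous_measurable_fun.
have c1 := @ge0_cvgn_integral R mu _ (@gauss_fun_ge0 R) mg.
have c2 := @ge0_cvgn_integral R mu _ sqr_gauss_ge0 msg.
have c3 : (n%:R * gauss_fun (n%:R : R))%:E +
      2%:E * \int[mu]_(x in `[0%R, n%:R]) (sqr_gauss x)%:E @[n --> \oo] -->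
    0%:E + 2%:E * \int[mu]_(x in `[0%R, +oo[) (sqr_gauss x)%:E.
  apply: cvgeD => //.
    by apply: cvg_EFin; [exact: nearW|exact: cvg_mul_gauss].
  exact: cvgeZl.
have : 2%:E * \int[mu]_(x in `[0%R, +oo[) (sqr_gauss x)%:E = (Num.sqrt pi / 2)%:E.
  rewrite -integral0y_gauss -[LHS]add0e.
  apply: (@cvg_unique _ (@ereal_hausdorff R)
    ((fun n : nat => \int[mu]_(x in `[0%R, n%:R]) (gauss_fun x)%:E) @ \oo)) => //.
  apply: cvg_trans c3; apply: near_eq_cvg; apply: nearW => n.
  by rewrite integral_sqr_gauss_itv.
move: (\int[mu]_(x in _) _) => I I2.
have -> : I = (2^-1)%:E * (2%:E * I) by rewrite muleA -EFinM mulVf ?mul1e.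
by rewrite I2 -EFinM; congr (_%:E); lra.
Qed.

(** Computed first for the deviation [1 / sqrt 2], where the density is
    proportional to [gauss_fun]. *)
Lemma second_moment_normal :
  \int[normal_prob (0 : R) 1]_x (x ^+ 2)%:E = 1.
Proof.
pose s : R := ((Num.sqrt 2)^-1)%R.
have s0 : (0 < s)%R by rewrite invr_gt0 sqrtr_gt0.
have s2 : (s ^+ 2 = 2^-1)%R by rewrite exprVn sqr_sqrtr.
have msqr : measurable_fun setT (fun x : R => (x ^+ 2)%:E).
  by apply/measurable_EFinP; exact: measurable_funX.
have sqr0 (x : R) : 0 <= (x ^+ 2)%:E by rewrite lee_fin sqr_ge0.
have pdfE (x : R) : normal_pdf 0 s x = ((Num.sqrt pi)^-1 * gauss_fun x)%R.
  rewrite normal_pdfE ?gt_eqF// /normal_peak /normal_fun subr0 s2.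
  have -> : (2^-1 *+ 2 = 1 :> R)%R by rewrite mulr2n; lra.
  have -> : (2^-1 * pi *+ 2 = pi :> R)%R.
    by rewrite mulr2n; lra.
  by rewrite divr1.
have h1 : \int[normal_prob 0%R s]_x (x ^+ 2)%:E = (2^-1)%:E.
  rewrite ge0_integral_normal_prob//.
  transitivity (\int[mu]_x (((Num.sqrt pi)^-1)%:E * (sqr_gauss x)%:E)).
    by apply: eq_integral => x _; rewrite pdfE -!EFinM /sqr_gauss mulrCA.
  rewrite ge0_integralZl//; last 2 first.
    by apply/measurable_EFinP; exact: continuous_measurable_fun.
    by move=> x _; rewrite lee_fin sqr_gauss_ge0.
  rewrite (ge0_symfun_integralT sqr_gauss_ge0 cont_sqr_gauss); last first.
    by move=> x /=; rewrite /sqr_gauss /gauss_fun sqrrN.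
  have -> : [set x : R | (0 <= x)%R] = `[0%R, +oo[%classic.
    by apply/seteqP; split => x/=; rewrite in_itv/= andbT.
  rewrite integral0y_sqr_gauss -!EFinM; congr (_%:E).
  have pi0 : Num.sqrt pi != 0%R :> R by rewrite gt_eqF// sqrtr_gt0 pi_gt0.
  by field.
have h2 : \int[normal_prob 0%R s]_x (x ^+ 2)%:E =
    (2^-1)%:E * \int[normal_prob (0 : R) 1]_x (x ^+ 2)%:E.
  rewrite (eq_measure_integral (law (normal_prob 0 1) (measurable_scale s))).
    rewrite ge0_integral_law// -ge0_integralZl//.
    by apply: eq_integral => x _; rewrite exprMn s2 EFinM.
  by move=> A mA _; have := normal_prob_scale s0 mA.
move: h2; rewrite h1; move: (\int[_]_x _) => I h2.
have -> : I = 2%:E * ((2^-1)%:E * I) by rewrite muleA -EFinM mulfV ?mul1e.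
by rewrite -h2 -EFinM mulfV.
Qed.

End normal.

(** * Asymptotically invariant events *)

Section asymptotically_invariant.
Context d (T : measurableType d) {R : realType} (P : probability T R).
Variable U : nat -> T -> T.
Hypothesis mU : forall n, measurable_fun setT (U n).
Hypothesis PU : forall n (A : set T), measurable A -> P (U n @^-1` A) = P A.
Local Open Scope ereal_scope.

(** These events form a sigma-algebra, so that this property of all events can be
    tested on generators. *)
Definition asy_invariant (A : set T) := measurable A /\
  forall e : R, (0 < e)%R -> exists N, forall n, (N <= n)%N ->
    P (A `\` U n @^-1` A) <= e%:E.

Let mleaves A n : measurable A -> measurable (A `\` U n @^-1` A).
Proof. by move=> mA; apply: measurableD => //; exact: measurable_preimage. Qed.

Lemma probability_setU_le (A B : set T) : measurable A -> measurable B ->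
  P (A `|` B) <= P A + P B.
Proof.
move=> mA mB; rewrite -(setDUK (@subsetUl _ A B)) measureU//.
- rewrite leeD2l// le_measure ?inE//.
    by apply: measurableD => //; exact: measurableU.
  by move=> t [[//|]].
- by apply: measurableD => //; exact: measurableU.
- by rewrite setDE setICA setICr setI0.
Qed.

Lemma asy_invariant_setC A : asy_invariant A -> asy_invariant (~` A).
Proof.
move=> [mA PA]; split; first exact: measurableC.
move=> e e0; have [N PN] := PA e e0; exists N => n Nn.
have mUA := measurable_preimage (mU n) mA.
have -> : ~` A `\` U n @^-1` (~` A) = U n @^-1` A `\` A.
  by rewrite preimage_setC !setDE setCK setIC.
suff -> : P (U n @^-1` A `\` A) = P (A `\` U n @^-1` A) by exact: PN.
have foo (B : set T) : measurable B -> P B < +oo.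
  by move=> mB; rewrite (le_lt_trans (probability_le1 P mB))// ltry.
rewrite !measureD ?foo//; congr (_ - _); first exact: PU.
by rewrite setIC.
Qed.

Section cover.
Variable A : nat -> set T.
Hypothesis aA : forall i, asy_invariant (A i).

Let mA i : measurable (A i). Proof. by have [] := aA i. Qed.

Let finite_leaves m (e : R) : (0 < e)%R -> exists N, forall n, (N <= n)%N ->
  P (\bigcup_(i in `I_m) (A i `\` U n @^-1` A i)) <= e%:E.
Proof.
elim: m e => [|m IH] e e0.
  by exists 0%N => n _; rewrite II0 bigcup_set0 measure0 lee_fin ltW.
have e20 : (0 < e / 2)%R by rewrite divr_gt0.
have [N1 h1] := IH _ e20; have [_ /(_ _ e20)[N2 h2]] := aA m.
exists (maxn N1 N2) => n; rewrite geq_max => /andP[n1 n2].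
have mF : measurable (\bigcup_(i in `I_m) (A i `\` U n @^-1` A i)).
  by apply: bigcup_measurable => i _; exact: mleaves.
rewrite IIS bigcup_setU bigcup_set1.
rewrite (le_trans (probability_setU_le mF (mleaves n (mA m))))//.
by rewrite [e]splitr EFinD leeD// ?h1// h2.
Qed.

(** Up to a small event, finitely many of the sets [A i] cover the union, and
    [U n] rarely moves a point out of one of these finitely many sets. *)
Lemma asy_invariant_cover (e : R) : (0 < e)%R -> exists N, forall n, (N <= n)%N ->
  P (\bigcup_i A i `\` \bigcup_i (A i `&` U n @^-1` A i)) <= e%:E.
Proof.
move=> e0; have e20 : (0 < e / 2)%R by rewrite divr_gt0.
pose B m := \bigcup_i A i `\` \bigcup_(i in `I_m) A i.
have mB m : measurable (B m).
  apply: measurableD; first exact: bigcupT_measurable.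
  by apply: bigcup_measurable => i _.
have B0 : \bigcap_m B m = set0.
  apply/seteqP; split=> // t Bt; have [[i _ Ai] _] := Bt 0%N I.
  by have [_] := Bt i.+1 I; apply; exists i => /=.
have : (P \o B) @ \oo --> P (\bigcap_m B m).
  apply: nonincreasing_cvg_mu => //.
  - by rewrite (le_lt_trans (probability_le1 P _))// ltry.
  - by rewrite B0.
  - move=> m n mn; apply/subsetPset; apply: setDS.
    by apply: bigcup_sub => i /= im t At; exists i => //=; exact: leq_trans mn.
rewrite B0 measure0 => /fine_cvgP[fB /cvgrPdist_le/(_ _ e20) cB].
have [m Bm] : exists m, P (B m) <= (e / 2)%:E.
  near \oo => m; exists m.
  rewrite -[P _]fineK ?lee_fin; last by near: m.
  have : (`|0 - fine (P (B m))| <= e / 2)%R by near: m.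
  by rewrite sub0r normrN; apply: le_trans; exact: ler_norm.
have [N PN] := finite_leaves m e20; exists N => n Nn.
have mF : measurable (\bigcup_(i in `I_m) (A i `\` U n @^-1` A i)).
  by apply: bigcup_measurable => i _; exact: mleaves.
apply: (@le_trans _ _ (P (B m `|` \bigcup_(i in `I_m) (A i `\` U n @^-1` A i)))).
  apply: le_measure; rewrite ?inE.
  - apply: measurableD; first exact: bigcupT_measurable.
    apply: bigcupT_measurable => i; apply: measurableI => //.
    exact: measurable_preimage.
  - exact: measurableU.
  - move=> t [At nt]; have [Bt|Bt] := pselect (B m t); [by left|right].
    have [i im Ai] : (\bigcup_(i in `I_m) A i) t.
      by apply: contrapT => nA; apply: Bt.
    by exists i => //; split=> // Ut; apply: nt; exists i.
rewrite (le_trans (probability_setU_le (mB m) mF))//.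
by rewrite [e]splitr EFinD leeD// PN.
Unshelve. all: by end_near. Qed.

Lemma asy_invariant_bigcup : asy_invariant (\bigcup_i A i).
Proof.
split; first exact: bigcupT_measurable.
move=> e e0; have [N PN] := asy_invariant_cover e0; exists N => n /PN.
apply: le_trans; apply: le_measure; rewrite ?inE.
- by apply: mleaves; exact: bigcupT_measurable.
- apply: measurableD; first exact: bigcupT_measurable.
  apply: bigcupT_measurable => i; apply: measurableI => //.
  exact: measurable_preimage.
- by move=> t [At Ut]; split=> // -[i _ [_ Ui]]; apply: Ut; exists i.
Qed.

End cover.

Lemma sigma_algebra_asy_invariant : sigma_algebra setT asy_invariant.
Proof.
split.
- split=> // e e0; exists 0%N => n _.
  by rewrite set0D measure0 lee_fin ltW.
- by move=> A /asy_invariant_setC; rewrite setTD.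
- by move=> A; exact: asy_invariant_bigcup.
Qed.

End asymptotically_invariant.

(** * The canonical Gaussian measure on cylinder sets *)

Section mk_linear.
Context {R : realType} {V W : lmodType R} {f : V -> W} (lf : linear f).

Definition mk_linear : {linear V -> W} :=
  HB.pack f (GRing.isLinear.Build R V W *:%R f lf).

Lemma mk_linearE x : mk_linear x = f x.
Proof. by []. Qed.

End mk_linear.

Section cylinders.
Context {R : realType} (H : hilbertType R) (nu : set H -> \bar R).
Hypothesis nuH : canonical_gaussian nu.

Lemma std_gauss1 (B : set (measurableTypeR R)) : measurable B ->
  std_gauss [set t : 1.-tuple (measurableTypeR R) | B (tnth t ord0)] =
  normal_prob 0 1 B.
Proof.
move=> mB; rewrite /std_gauss /pushforward/=.
have -> : (fun p : measurableTypeR R * 0.-tuple (measurableTypeR R) =>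
    [tuple of p.1 :: p.2]) @^-1` [set t | B (tnth t ord0)] = B `*` setT.
  by apply/seteqP; split=> [[x t]|[x t] []] /=; rewrite /preimage/= (tnth_nth 0).
rewrite (@product_measure1E _ _ _ _ _ (normal_prob 0 1) (\d_[tuple]))//.
by rewrite [X in (_ * X)%E](_ : _ = 1%E) ?mule1//; exact: diracT.
Qed.

Section finite_projection.
Variables (n : nat) (e : 'I_n -> H).
Hypothesis oe : Defs.orthonormal e.

Definition fproj_fun (x : H) : H := \sum_(i < n) ip H x (e i) *: e i.

Lemma fproj_linear : linear fproj_fun.
Proof.
move=> a x y; rewrite /fproj_fun scaler_sumr -big_split/=.
by apply: eq_bigr => i _; rewrite ipDl ipZl scalerDl scalerA.
Qed.

Definition fproj : {linear H -> H} := mk_linear fproj_linear.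

Lemma fproj_lin_comb t : fproj (lin_comb e t) = lin_comb e t.
Proof.
apply: eq_bigr => i _; congr (_ *: _); rewrite ip_suml (bigD1 i)//= ipZl oe eqxx.
rewrite mulr1 big1 ?addr0// => j /negbTE ji.
by rewrite ipZl oe ji mulr0.
Qed.

Lemma range_fproj x : exists t, fproj x = lin_comb e t.
Proof.
exists [tuple ip H x (e i) | i < n].
by apply: eq_bigr => i _; rewrite tnth_mktuple.
Qed.

Lemma fin_proj_fproj : fin_proj fproj.
Proof.
split=> [x|x y|].
- by have [t ->] := range_fproj x; exact: fproj_lin_comb.
- rewrite /= /fproj_fun ip_suml ip_sumr; apply: eq_bigr => i _.
  by rewrite ipZl ipZr mulrC (ipC y).
- exists n, e => _ [x _ <-]; have [t ->] := range_fproj x.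
  by exists t.
Qed.

Lemma canonical_gaussian_fproj (B : set (borel H)) : measurable B ->
  nu [set x | B (fproj x)] = std_gauss [set t | B (lin_comb e t)].
Proof.
move=> mB; apply: (nuH fin_proj_fproj oe) => //.
apply/seteqP; split=> _ [x _ <-].
  by exists (lin_comb e x) => //; exact: fproj_lin_comb.
by have [t ->] := range_fproj x; exists t.
Qed.

End finite_projection.

Lemma measurable_ip (h : H) (B : set (measurableTypeR R)) : measurable B ->
  measurable [set x : borel H | B (ip H h x)].
Proof.
move=> mB.
have mf : measurable_fun setT (fun x : borel H => ip H x h : measurableTypeR R).
  by apply: continuous_borel_real; exact: ip_continuous.
have := measurable_preimage mf mB; congr measurable.
by apply/seteqP; split=> x; rewrite /preimage/= ipC.
Qed.

(** The form [ip H h] only depends on the projection onto the line of [h]. *)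
Lemma canonical_gaussian_form (h : H) (B : set (measurableTypeR R)) :
  h != 0 -> measurable B -> nu [set x | B (ip H h x)] = normal_prob 0 `|h| B.
Proof.
move=> h0 mB; have nh0 : `|h| != 0 by rewrite normr_eq0.
pose e := fun _ : 'I_1 => `|h|^-1 *: h.
have oe : Defs.orthonormal e.
  by move=> i j; rewrite !ord1 eqxx ipZl ipZr ipE mulr1n; field.
pose Bh : set (borel H) := [set y | B (ip H h y)].
have hP x : ip H h (fproj e x) = ip H h x.
  by rewrite /= /fproj_fun big_ord1 !ipZr ipE (ipC x); field.
have hL t : ip H h (lin_comb e t) = `|h| * tnth t ord0.
  by rewrite /lin_comb big_ord1 !ipZr ipE; field.
transitivity (nu [set x | Bh (fproj e x)]).
  by congr nu; apply/seteqP; split=> x; rewrite /Bh/= hP.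
rewrite canonical_gaussian_fproj//; last exact: measurable_ip.
have mS := measurable_preimage (measurable_scale `|h|) mB.
have h1 : 0 < `|h| by rewrite normr_gt0.
apply: (eq_trans _ (esym (normal_prob_scale h1 mB))).
apply: (eq_trans _ (std_gauss1 mS)).
by congr std_gauss; apply/seteqP; split=> t; rewrite /Bh /preimage/= hL.
Qed.

Section flip_invariance.
Variable e : nat -> H.
Hypothesis oe : orthosystem e.

(** Two orthonormal bases of the same space, here [e] and [e] up to signs, give
    the same Gaussian measure. *)
Lemma canonical_gaussian_flip n N (B : set (borel H)) : measurable B ->
  nu [set x | B (flip e n (proj e x N))] = nu [set x | B (proj e x N)].
Proof.
move=> mB; pose I := [seq i <- iota 0 N | e i != 0].
have uI : uniq I by rewrite filter_uniq// iota_uniq.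
have nI (k : 'I_(size I)) : e (nth 0%N I k) != 0.
  by have := mem_nth 0%N (ltn_ord k); rewrite mem_filter => /andP[].
pose sgn i : R := if (i < n)%N then 1 else -1.
have sgn2 i : sgn i * sgn i = 1 by rewrite /sgn; case: ifP; rewrite ?mulrNN mul1r.
pose u (k : 'I_(size I)) := e (nth 0%N I k).
pose v (k : 'I_(size I)) := sgn (nth 0%N I k) *: u k.
have ou : Defs.orthonormal u.
  by move=> i j; rewrite /u oe nI andbT nth_uniq// -val_eqE.
have ov : Defs.orthonormal v.
  move=> i j; rewrite /v ipZl ipZr ou.
  by have [->|_] := eqVneq i j; rewrite ?mulr0// mulr1 sgn2.
have pu x : proj e x N = fproj u x.
  rewrite /proj /partial_comb /= /fproj_fun.
  rewrite -(big_mkord xpredT (fun k => ip H x (e (nth 0%N I k)) *: e (nth 0%N I k))).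
  rewrite -(big_nth 0%N xpredT (fun i => ip H x (e i) *: e i)) big_filter.
  rewrite /index_iota subn0 [RHS]big_mkcond/=; apply: eq_bigr => i _.
  by have [->|//] := eqVneq (e i) 0; rewrite scaler0.
have pv x : proj e x N = fproj v x.
  rewrite pu; apply: eq_bigr => k _.
  by rewrite /v ipZr scalerA mulrAC sgn2 mul1r.
have -> : [set x | B (flip e n (proj e x N))] =
    [set x | (flip e n @^-1` B) (fproj u x)].
  by apply/seteqP; split=> x /=; rewrite pu.
have mfB : measurable (flip e n @^-1` B : set (borel H)).
  by apply: measurable_preimage mB; apply: continuous_borel; exact: flip_continuous.
rewrite (canonical_gaussian_fproj ou mfB).
have -> : [set t | (flip e n @^-1` B) (lin_comb u t)] = [set t | B (lin_comb v t)].
  have flipE t : flip e n (lin_comb u t) = lin_comb v t.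
    rewrite -[flip e n]/(mk_linear (flip_linear e n) : H -> H) linear_sum.
    apply: eq_bigr => k _; rewrite linearZ; congr (_ *: _).
    exact: flip_basis.
  by apply/seteqP; split=> t; rewrite /preimage/= flipE.
rewrite -(canonical_gaussian_fproj ov mB).
by congr nu; apply/seteqP; split=> x /=; rewrite pv.
Qed.

End flip_invariance.

End cylinders.

(** * Functionals and bases for a Gaussian measure *)

Section tvs_facts.
Context {R : realType} {X Y : tvsType R}.

Lemma tvs_continuousD (f g : X -> Y) :
  continuous f -> continuous g -> continuous (fun x => f x + g x).
Proof.
move=> cf cg x; apply: (@cvg_comp _ _ _ (fun x => (f x, g x)) (fun z => z.1 + z.2)
  _ (nbhs (f x, g x))).
  by apply: cvg_pair; [exact: cf|exact: cg].
exact: (@add_continuous Y (f x, g x)).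
Qed.

Lemma tvs_continuousB (f g : X -> Y) :
  continuous f -> continuous g -> continuous (fun x => f x - g x).
Proof.
move=> cf cg x; apply: (@cvg_comp _ _ _ (fun x => (f x, g x)) (fun z => z.1 - z.2)
  _ (nbhs (f x, g x))).
  by apply: cvg_pair; [exact: cf|exact: cg].
exact: (@sub_continuous Y (f x, g x)).
Qed.

Lemma tvs_continuousZ (f : X -> R) (y : Y) :
  continuous f -> continuous (fun x => f x *: y).
Proof.
move=> cf x; apply: (@cvg_comp _ _ _ (fun x => (f x : R^o, y)) (fun z => z.1 *: z.2)
  _ (nbhs (f x : R^o, y))).
  by apply: (@cvg_pair _ _ _ _ (nbhs (f x : R^o))); [exact: cf|exact: cvg_cst].
exact: (@scale_continuous R Y (f x : R^o, y)).
Qed.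

Lemma tvs_continuous_sum (I : Type) (r : seq I) (f : I -> X -> Y) :
  (forall i, continuous (f i)) -> continuous (fun x => \sum_(i <- r) f i x).
Proof.
move=> cf; elim: r => [|i r IH].
  by under eq_fun do rewrite big_nil; move=> x; exact: cvg_cst.
by under eq_fun do rewrite big_cons; exact: tvs_continuousD.
Qed.

Lemma fnormB_continuous (q : nat -> Y -> R) (f g : X -> Y) k : frechet q ->
  continuous f -> continuous g -> continuous (fun x => q k (f x - g x)).
Proof.
move=> frY cf cg x.
apply: (@continuous_comp _ _ _ (fun x => f x - g x) (q k)).
  exact: tvs_continuousB.
exact: fnorm_continuous.
Qed.

End tvs_facts.

Lemma dense_eq (A X Y : topologicalType) (i : A -> X) (f g : X -> Y) :
  hausdorff_space Y -> dense (range i) -> continuous f -> continuous g ->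
  (forall a, f (i a) = g (i a)) -> f = g.
Proof.
move=> hY di cf cg fg; apply/funext => x; apply: hY => U V Uf Vg.
have : nbhs x ((f @^-1` U) `&` (g @^-1` V)).
  by apply: filterI; [exact: cf|exact: cg].
rewrite nbhsE => -[W [Wo Wx] WUV].
have [y [Wy [a _ ay]]] := di W (ex_intro _ x Wx) Wo.
by have [] := WUV _ Wy; rewrite -ay /preimage/= -fg => Uy Vy; exists (f (i a)).
Qed.

Section gaussian_frechet.
Context {R : realType} (H : hilbertType R) (F : tvsType R).
Variables (q : nat -> F -> R) (nu : set H -> \bar R) (iota : {linear H -> F}).
Variable gamma : probability (borel F) R.
Hypothesis nuH : canonical_gaussian nu.
Hypothesis awsF : abstract_wiener_space q nu iota.
Hypothesis gammaE : extends_image nu iota gamma.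

Let frF : frechet q := aws_frechet awsF.
Let sepF : Defs.separable F := aws_separableF awsF.
Let sepH : Defs.separable H := aws_separableH awsF.

Let iota_continuous : continuous iota. Proof. by have [] := aws_embedding awsF. Qed.
Let iota_inj : injective iota. Proof. by have [] := aws_embedding awsF. Qed.
Let iota_dense : dense (range iota). Proof. by have [] := aws_embedding awsF. Qed.

Lemma gaussian_rectangle (f : nat -> {linear F -> R^o})
    (A : nat -> set (measurableTypeR R)) M :
  (forall n, continuous (f n)) -> (forall n, measurable (A n)) ->
  gamma [set y | forall m, (m < M)%N -> A m (f m y)] =
  nu [set x | forall m, (m < M)%N -> A m (f m (iota x))].
Proof.
move=> cf mA.
pose B : set (M.-tuple (measurableTypeR R)) :=
  [set t | forall i : 'I_M, A i (tnth t i)].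
have mB : measurable B.
  have -> : B = \bigcap_(i in [set: 'I_M]) ((fun t => tnth t i) @^-1` A i).
    by apply/seteqP; split=> t Bt i; [move=> _; exact: Bt|exact: (Bt i I)].
  apply: fin_bigcap_measurable => // i _.
  exact: measurable_preimage (measurable_tnth i) (mA i).
have BE (y : F) : B [tuple f i y | i < M] <-> forall m, (m < M)%N -> A m (f m y).
  split=> [By m mM|Ay i]; last by rewrite tnth_mktuple; exact: Ay.
  by have := By (Ordinal mM); rewrite tnth_mktuple.
have := @gammaE M (fun i => f i) B (fun i => cf i) mB; rewrite /=.
have -> : [set x : F | B [tuple f i x | i < M]] =
    [set y | forall m, (m < M)%N -> A m (f m y)].
  by apply/seteqP; split=> y /= /BE.
by move=> ->.
Qed.

Definition represents (f : {linear F -> R^o}) (h : H) :=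
  forall x, f (iota x) = ip H h x.

Lemma adjoint (f : {linear F -> R^o}) : continuous f -> exists h, represents f h.
Proof.
move=> cf.
have lf : linear ((f \o iota) : H -> R^o) by move=> a x y /=; rewrite !linearP.
have [|h hE] := riesz (f := mk_linear lf) sepH; last by exists h.
by move=> x; apply: continuous_comp; [exact: iota_continuous|exact: cf].
Qed.

Lemma dual_eq (f g : {linear F -> R^o}) : continuous f -> continuous g ->
  (forall x, f (iota x) = g (iota x)) -> forall y, f y = g y.
Proof.
move=> cf cg fg y.
by rewrite (@dense_eq _ _ _ iota f g (@Rhausdorff R) iota_dense cf cg fg).
Qed.

Lemma gaussian_law (f : {linear F -> R^o}) h (B : set (measurableTypeR R)) :
  continuous f -> represents f h -> h != 0 -> measurable B ->
  gamma (f @^-1` B) = normal_prob 0 `|h| B.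
Proof.
move=> cf fh h0 mB; rewrite -(canonical_gaussian_form nuH h0 mB).
have := @gaussian_rectangle (fun=> f) (fun=> B) 1 (fun=> cf) (fun=> mB).
have -> : [set y | forall m, (m < 1)%N -> B (f y)] = f @^-1` B.
  by apply/seteqP; split=> y /=; [apply; exact: (ltnSn 0)|].
move=> ->; congr nu; apply/seteqP; split=> x /=; rewrite fh => //.
by apply; exact: (ltnSn 0).
Qed.

(** Gram-Schmidt is applied to the vectors [h n] that represent a norming sequence
    [g].  The result [e] is total because [g] separates the points of [F], and its
    vectors are linear combinations of the [h n], so that they are represented by
    functionals [f n] too. *)
Lemma gaussian_basis : exists (g : nat -> {linear F -> R^o}) (h : nat -> H)
    (e : nat -> H) (f : nat -> {linear F -> R^o}),
  [/\ (forall n, continuous (g n)),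
      (forall k x r, 0 < r ->
        exists2 n, (forall y, `|g n y| <= q k y) & q k x - r < g n x) &
      forall n, represents (g n) (h n)] /\
  [/\ orthosystem e, total_system e, forall n, h n = proj e (h n) n.+1,
      (forall n, continuous (f n)) & forall n, represents (f n) (e n)].
Proof.
have [g [cg gP]] := norming_sequence frF sepF.
have /choice[h hP] n : exists h, represents (g n) h by exact: adjoint.
have [e [oe hE eP]] := gram_schmidt h.
pose Q x := exists f : {linear F -> R^o}, continuous f /\ represents f x.
have /choice[f fP] : forall n, Q (e n).
  apply: eP => [a x y [fx [cx fxE]] [fy [cy fyE]]||n].
  - have lf : linear ((fun z => a * (fx z : R) + (fy z : R)) : F -> R^o).
      move=> b u v; have E : a * (fx (b *: u + v) : R) + (fy (b *: u + v) : R) =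
          b * (a * (fx u : R) + (fy u : R)) + (a * (fx v : R) + (fy v : R)) :> R.
        by rewrite !dualD !dualZ; ring.
      exact: E.
    exists (mk_linear lf); split.
      move=> z; apply: cvgD; last exact: cy.
      by apply: cvgM; [exact: cvg_cst|exact: cx].
    by move=> z; rewrite mk_linearE fxE fyE ipDl ipZl.
  - have lf : linear ((fun _ => 0) : F -> R^o).
      by move=> b u v; rewrite scaler0 addr0.
    exists (mk_linear lf); split; first by move=> z; exact: cvg_cst.
    by move=> z; rewrite ip0l.
  - by exists (g n).
exists g, h, e, f; split; split=> //; last 2 first.
- by move=> n; have [] := fP n.
- by move=> n; have [] := fP n.
move=> x xe; apply: iota_inj; rewrite linear0; apply: (norming_separates frF gP) => n.
rewrite hP hE ip_suml big1// => i _.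
by rewrite ipZl (ipC (e i)) xe mulr0.
Qed.

End gaussian_frechet.

(** * Convergence of the expansion in measure *)

Section expansion.
Context {R : realType} (H : hilbertType R) (F : tvsType R).
Variables (q : nat -> F -> R) (nu : set H -> \bar R) (iota : {linear H -> F}).
Variable gamma : probability (borel F) R.
Hypothesis nuH : canonical_gaussian nu.
Hypothesis awsF : abstract_wiener_space q nu iota.
Hypothesis gammaE : extends_image nu iota gamma.
Variables (g : nat -> {linear F -> R^o}) (h : nat -> H).
Variables (e : nat -> H) (f : nat -> {linear F -> R^o}).
Hypothesis cg : forall n, continuous (g n).
Hypothesis gP : forall k x r, 0 < r ->
  exists2 n, (forall y, `|g n y| <= q k y) & q k x - r < g n x.
Hypothesis gh : forall n, represents iota (g n) (h n).
Hypothesis oe : orthosystem e.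
Hypothesis hE : forall n, h n = proj e (h n) n.+1.
Hypothesis cf : forall n, continuous (f n).
Hypothesis fe : forall n, represents iota (f n) (e n).

Let frF : frechet q := aws_frechet awsF.
Let sepF : Defs.separable F := aws_separableF awsF.

Definition expansion n (y : F) : F := \sum_(0 <= i < n) (f i y : R) *: iota (e i).

Lemma expansion_continuous n : continuous (expansion n).
Proof.
by apply: tvs_continuous_sum => i; apply: tvs_continuousZ; exact: cf.
Qed.

Lemma expansion_linear n : linear (expansion n).
Proof.
move=> a x y; rewrite /expansion scaler_sumr -big_split/=.
by apply: eq_bigr => i _; rewrite dualD dualZ scalerDl scalerA.
Qed.

Lemma expansion_iota n x : expansion n (iota x) = iota (proj e x n).
Proof.
rewrite /expansion /proj /partial_comb linear_sum; apply: eq_bigr => i _.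
by rewrite fe linearZ/= ipC.
Qed.

Definition reflection n (y : F) : F := 2 *: expansion n y - y.

Lemma reflection_linear n : linear (reflection n).
Proof.
move=> a x y; rewrite /reflection expansion_linear !scalerDr !scalerA opprD addrACA.
by rewrite (mulrC 2) scalerN.
Qed.

Lemma reflection_continuous n : continuous (reflection n).
Proof.
have -> : reflection n = fun y => expansion n y + (expansion n y + -1 *: y).
  by apply/funext => y; rewrite /reflection scaleN1r scaler_nat mulr2n addrA.
have c := @expansion_continuous n.
apply: tvs_continuousD => //; apply: tvs_continuousD => // y.
apply: (@cvg_comp _ _ _ (fun y => (-1 : R^o, y)) (fun z => z.1 *: z.2)
  _ (nbhs (-1 : R^o, y))).
  by apply: (@cvg_pair _ _ _ _ (nbhs (-1 : R^o))); [exact: cvg_cst|exact: cvg_id].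
exact: (@scale_continuous R F (-1 : R^o, y)).
Qed.

Lemma reflection_iota n x : reflection n (iota x) = iota (flip e n x).
Proof. by rewrite /reflection expansion_iota /flip linearB linearZ. Qed.

Lemma ip_functional_proj m n x : (m < n)%N -> ip H (h m) (proj e x n) = ip H (h m) x.
Proof. by move=> mn; rewrite hE !ip_proj// proj_proj. Qed.

(** [h m] lies in the span of the first [m.+1] vectors of [e], which
    [reflection n] fixes. *)
Lemma functional_reflection m n y : (m < n)%N -> g m (reflection n y) = g m y.
Proof.
move=> mn; have lin : linear (g m \o reflection n : F -> R^o).
  by move=> a u v /=; rewrite reflection_linear linearP.
apply: (@dual_eq _ _ _ _ _ _ awsF (mk_linear lin) (g m)) => [u||x].
- apply: continuous_comp; first exact: reflection_continuous.
  exact: cg.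
- exact: cg.
- rewrite mk_linearE /= reflection_iota !gh /flip ipBr ipZr ip_functional_proj//.
  by rewrite mulr_natl mulr2n addrK.
Qed.

Let cylinder : set (set (borel F)) := [set C |
  exists M (A : nat -> set (measurableTypeR R)),
  (forall n, measurable (A n)) /\ C = [set y | forall m, (m < M)%N -> A m (g m y)]].

Let borel_cylinder : @measurable _ (borel F) = <<s cylinder >>.
Proof.
apply/seteqP; split.
  apply: (norming_generates frF sepF gP); first exact: smallest_sigma_algebra.
  move=> n c; apply: sub_sigma_algebra; exists n.+1.
  exists (fun m => if m == n then `]-oo, c]%classic else setT); split.
    by move=> m; case: ifP.
  apply/seteqP; split=> y /=.
    by move=> gy m _; case: eqP => // ->; rewrite /= in_itv.
  by move=> /(_ n (ltnSn n)); rewrite eqxx /= in_itv.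
apply: smallest_sub; first exact: sigma_algebra_measurable.
move=> _ [M [A [mA ->]]].
have -> : [set y | forall m, (m < M)%N -> A m (g m y)] =
    \bigcap_(m in [set m | (m < M)%N]) (g m @^-1` A m) by [].
apply: bigcap_measurableType => m _.
have mg : measurable_fun setT (g m : borel F -> measurableTypeR R).
  by apply: continuous_borel_real; exact: cg.
exact: measurable_preimage mg (mA m).
Qed.

Lemma measurable_reflection n :
  measurable_fun setT (reflection n : borel F -> borel F).
Proof. by apply: continuous_borel; exact: reflection_continuous. Qed.

(** Cylinder sets determine [gamma], and on them [reflection n] acts as a change
    of signs in an orthonormal basis of [H]. *)
Lemma reflection_invariant n (A : set (borel F)) : measurable A ->
  gamma (reflection n @^-1` A) = gamma A.
Proof.
move=> mA; apply/esym.
apply: (@measure_unique _ R (borel F) cylinder (fun=> setT) borel_cylinder _ _ _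
  gamma (law gamma (measurable_reflection n))) => //.
- move=> _ _ [M [A1 [mA1 ->]]] [M' [A2 [mA2 ->]]].
  exists (maxn M M'), (fun m => (if (m < M)%N then A1 m else setT) `&`
                                 (if (m < M')%N then A2 m else setT)).
  split=> [m|]; first by apply: measurableI; case: ifP.
  apply/seteqP; split=> y /=.
    by move=> [y1 y2] m _; split; case: ifP => // mM; [exact: y1|exact: y2].
  move=> ym; split=> m mM.
    by have := ym m (leq_trans mM (leq_maxl _ _)); rewrite mM => -[].
  by have := ym m (leq_trans mM (leq_maxr _ _)); rewrite mM => -[].
- move=> _; exists 0%N, (fun=> setT); split=> //.
  by apply/seteqP; split=> // y _ m; rewrite ltn0.
- by apply/seteqP; split=> // y _; exists 0%N.
- move=> _ [M [A1 [mA1 ->]]]; rewrite /= /distribution /pushforward.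
  have clin m : linear (g m \o reflection n : F -> R^o).
    by move=> a u v /=; rewrite reflection_linear linearP.
  have cgr m : continuous (mk_linear (clin m)).
    by move=> u; apply: continuous_comp; [exact: reflection_continuous|exact: cg].
  rewrite (gaussian_rectangle gammaE M cg mA1).
  rewrite [RHS](gaussian_rectangle gammaE M cgr mA1).
  pose B : set (borel H) := [set x | forall m, (m < M)%N -> A1 m (ip H (h m) x)].
  have mB : measurable B.
    have -> : B = \bigcap_(m in [set m | (m < M)%N])
      [set x | A1 m (ip H (h m) x)] by [].
    by apply: bigcap_measurableType => m _; exact: measurable_ip.
  pose N := maxn M n.
  transitivity (nu [set x | B (proj e x N)]).
    congr nu; apply/seteqP; split=> x Bx m mM.
      by rewrite ip_functional_proj -?gh; [exact: Bx|rewrite leq_max mM].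
    have := Bx m mM; rewrite ip_functional_proj -?gh//.
    by rewrite leq_max mM.
  rewrite -(canonical_gaussian_flip nuH oe n N mB); congr nu.
  have flipE m x : (m < M)%N ->
      ip H (h m) (flip e n (proj e x N)) = g m (reflection n (iota x)).
    move=> mM; rewrite reflection_iota gh /flip !ipBr ip_functional_proj; last first.
      by rewrite leq_max mM.
    by rewrite proj_proj// leq_maxr.
  by apply/seteqP; split=> x Bx m mM; have := Bx m mM; rewrite flipE.
- by move=> _; rewrite [X in (X < _)%E](_ : _ = 1%E) ?ltry//; exact: probability_setT.
Qed.

(** The half-spaces of [g m] are invariant under [reflection n] when [m < n]. *)
Lemma borel_asy_invariant (A : set (borel F)) : measurable A ->
  asy_invariant gamma (reflection : nat -> borel F -> borel F) A.
Proof.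
apply: (norming_generates frF sepF gP).
  exact: (sigma_algebra_asy_invariant measurable_reflection reflection_invariant).
move=> m c; split.
  have mg : measurable_fun setT (g m : borel F -> measurableTypeR R).
    by apply: continuous_borel_real; exact: cg.
  have := measurable_preimage mg (measurable_itv `]-oo, c]).
  by congr measurable; apply/seteqP; split=> y; rewrite /preimage/= in_itv.
move=> r r0; exists m.+1 => n mn.
rewrite (_ : _ `\` _ = set0) ?measure0 ?lee_fin ?ltW//.
apply/seteqP; split=> // y [/= gy]; apply.
by rewrite /preimage/= functional_reflection.
Qed.

(** A point and its reflection usually lie
    in the same small ball, and [y - expansion n y] is half their difference. *)
Lemma expansion_cvg_measure k (r d : R) : 0 < r -> 0 < d ->
  exists N, forall n, (N <= n)%N ->
    (gamma [set y | (r <= q k (y - expansion n y))%R] <= d%:E)%E.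
Proof.
move=> r0 d0; have [s sP] := frechet_dense_sequence frF sepF.
pose A i : set (borel F) := [set y | q k (y - s i) < r].
have mA i : measurable (A i) by apply: borel_open; exact: open_fball.
have [N NP] := asy_invariant_cover measurable_reflection
  (fun i => borel_asy_invariant (mA i)) d0.
exists N => n /NP; apply: le_trans; apply: le_measure; rewrite ?inE.
- have mq : measurable_fun setT
      (fun y : borel F => q k (y - expansion n y) : measurableTypeR R).
    apply: continuous_borel_real.
    apply: (@fnormB_continuous R F F q id (expansion n) k frF).
      by move=> y; exact: cvg_id.
    exact: expansion_continuous.
  have := measurable_preimage mq (measurable_itv `[r, +oo[).
  by congr measurable; apply/seteqP; split=> y; rewrite /preimage/= in_itv/= andbT.
- apply: measurableD; first exact: bigcupT_measurable.
  apply: bigcupT_measurable => i; apply: measurableI => //.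
  exact: measurable_preimage (measurable_reflection n) (mA i).
- move=> y /= ry; split.
    by have [i yi] := sP y k r r0; exists i.
  move=> [i _ [yi Uyi]]; move: ry; rewrite leNgt => /negP; apply.
  rewrite -(ltr_pM2l (ltr0n R 2)).
  have -> : 2%:R * q k (y - expansion n y) = q k (y - reflection n y).
    rewrite -[2%:R in LHS]ger0_norm// -(frechet_seminorm frF k).2; congr (q k _).
    by rewrite /reflection scalerBr opprB addrA; congr (_ - _); rewrite scaler_nat.
  rewrite (le_lt_trans (fnorm_triangle frF k _ (s i) _))//.
  by rewrite (fnormBC frF _ (s i)) mulr_natl mulr2n ltrD.
Qed.

End expansion.

(** * Diagonal embeddings and the synthesis map *)

Section diagonal_embedding.
Context {R : realType} (H : hilbertType R).
Variables (e : nat -> H) (a : nat -> R).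
Hypothesis oe : orthosystem e.
Hypothesis te : total_system e.
Hypothesis a01 : forall n, 0 < a n <= 1.

Let a_neq0 n : a n != 0. Proof. by have /andP[/gt_eqF -> _] := a01 n. Qed.

Lemma diagonal_exists : exists j : {linear H -> H},
  continuous j /\ forall x n, ip H (j x) (e n) = a n * ip H x (e n).
Proof.
have aip x n : \sum_(0 <= i < n) (a i * ip H x (e i)) ^+ 2 <= `|x| ^+ 2.
  rewrite (le_trans _ (bessel oe x n))//; apply: ler_sum => i _.
  have /andP[a0 a1] := a01 i.
  by rewrite exprMn ler_piMl ?sqr_ge0// expr_le1// ltW.
have /choice[j0 jE] x : exists y, forall n, ip H y (e n) = a n * ip H x (e n).
  have [y _ yE] := riesz_fischer oe (aip x); exists y => n.
  by rewrite yE -mulrA ip_null.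
have lj : linear j0.
  move=> b x y; apply: (total_eq te) => n.
  by rewrite jE !ipDl !ipZl !jE mulrDr mulrCA.
exists (mk_linear lj); split; last exact: jE.
apply: (@lipschitz_linear_continuous _ _ _ _ 1) => [x y|x].
  by rewrite linearB.
rewrite mul1r.
have cn : `|proj e (j0 x) n| @[n --> \oo] --> `|j0 x| by exact: cvg_norm_proj.
rewrite mk_linearE.
rewrite -(cvg_lim _ cn)//; apply: limr_le; first by apply/cvg_ex; eexists; exact: cn.
apply: nearW => n; rewrite -(@ler_pXn2r _ 2)// ?nnegrE// norm_proj//.
by under eq_bigr do rewrite jE; exact: aip.
Qed.

Variable j : {linear H -> H}.
Hypothesis jE : forall x n, ip H (j x) (e n) = a n * ip H x (e n).

Lemma diagonal_basis i : j (e i) = a i *: e i.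
Proof.
apply: (total_eq te) => n; rewrite jE ipZl oe.
by have [->|] := eqVneq i n; rewrite ?mulr0.
Qed.

Lemma diagonal_injective : injective j.
Proof.
move=> x y xy; apply: (total_eq te) => n.
by apply: (mulfI (a_neq0 n)); rewrite -!jE xy.
Qed.

Lemma proj_diagonal x n :
  proj e x n = j (partial_comb e (fun i => (a i)^-1 * ip H x (e i)) 0 n).
Proof.
rewrite linear_sum; apply: eq_bigr => i _.
by rewrite linearZ/= diagonal_basis scalerA mulrAC mulVf// mul1r.
Qed.

Lemma diagonal_dense : dense (range j).
Proof.
move=> W [x Wx] oW.
have : nbhs x W by exact: open_nbhs_nbhs.
move=> /(cvg_proj oe te)[N _ NW]; exists (proj e x N); split; first by apply: NW => /=.
by rewrite proj_diagonal; eexists.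
Qed.

End diagonal_embedding.

(** [j] multiplies the [i]-th coordinate by [a i].  The synthesis map undoes this
    and sums the resulting series in [F], along the indices [s N] for which the
    expansion in [F] is known to converge. *)
Section synthesis.
Context {R : realType} (H : hilbertType R) (F : tvsType R).
Variables (q : nat -> F -> R) (iota : {linear H -> F}).
Hypothesis frF : frechet q.
Hypothesis sepF : Defs.separable F.
Hypothesis iotaC : continuous iota.
Variables (e : nat -> H) (f : nat -> {linear F -> R^o}) (a : nat -> R) (s : nat -> nat).
Hypothesis oe : orthosystem e.
Hypothesis te : total_system e.
Hypothesis a01 : forall n, 0 < a n <= 1.
Hypothesis cf : forall n, continuous (f n).
Hypothesis fe : forall n, represents iota (f n) (e n).
Hypothesis sN : forall N, (N <= s N)%N.

Let a_neq0 n : a n != 0. Proof. by have /andP[/gt_eqF -> _] := a01 n. Qed.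

Definition synthesis N (x : H) : F :=
  \sum_(0 <= i < s N) ((a i)^-1 * ip H x (e i)) *: iota (e i).

Lemma synthesis_continuous N : continuous (synthesis N).
Proof.
apply: tvs_continuous_sum => i; apply: tvs_continuousZ => x.
by apply: cvgM; [exact: cvg_cst|exact: ip_continuous].
Qed.

Lemma synthesis_linear N : linear (synthesis N).
Proof.
move=> b x y; rewrite /synthesis scaler_sumr -big_split/=.
by apply: eq_bigr => i _; rewrite ipDl ipZl scalerA -scalerDl mulrDr mulrCA.
Qed.

Definition synthesis_domain : set (borel H) :=
  [set x | frechet_cauchy (q := q) (synthesis^~ x)].

Definition synthesis_lim : borel H -> borel F :=
  fun x => xget 0 [set l : F | synthesis^~ x @ \oo --> l].

Lemma synthesis_cvg x : synthesis_domain x ->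
  synthesis^~ x @ \oo --> (synthesis_lim x : F).
Proof. by move=> /(frechet_complete frF) h; exact: (xgetPex 0 h). Qed.

Lemma synthesis_limP x (l : F) : synthesis^~ x @ \oo --> l ->
  synthesis_domain x /\ synthesis_lim x = l.
Proof.
move=> xl; have Dx : synthesis_domain x by exact: frechet_cvg_cauchy xl.
by split=> //; exact: (frechet_cvg_unique frF (synthesis_cvg Dx) xl).
Qed.

Lemma synthesis_linear_on : @linear_on R H F synthesis_domain synthesis_lim.
Proof.
have key b (x y : H) : synthesis_domain x -> synthesis_domain y ->
    synthesis^~ (b *: x + y) @ \oo --> (b *: synthesis_lim x + synthesis_lim y : F).
  move=> /synthesis_cvg cx /synthesis_cvg cy.
  under eq_fun do rewrite synthesis_linear.
  apply: (@cvg_comp _ _ _ (fun N => (b *: synthesis N x, synthesis N y))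
    (fun z => z.1 + z.2) _ (nbhs (b *: (synthesis_lim x : F), (synthesis_lim y : F)))).
    apply: cvg_pair => //.
    apply: (@cvg_comp _ _ _ (fun N => (b : R^o, synthesis N x)) (fun z => z.1 *: z.2)
      _ (nbhs (b : R^o, (synthesis_lim x : F)))).
      by apply: (@cvg_pair _ _ _ _ (nbhs (b : R^o))); [exact: cvg_cst|].
    exact: (@scale_continuous R F (b : R^o, (synthesis_lim x : F))).
  exact: (@add_continuous F (b *: (synthesis_lim x : F), (synthesis_lim y : F))).
split.
- apply: (@synthesis_limP 0 0 _).1.
  have -> : synthesis^~ 0 = fun=> 0.
    apply/funext => N.
    by rewrite -[synthesis N]/(mk_linear (synthesis_linear N) : H -> F) linear0.
  exact: cvg_cst.
- by move=> b x y Dx Dy; apply: (synthesis_limP (key b x y Dx Dy)).1.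
- by move=> b x y Dx Dy; apply: (synthesis_limP (key b x y Dx Dy)).2.
Qed.

(** The functionals [f n] read the coordinates off the sum of the series, which
    makes the synthesis map injective. *)
Lemma functional_synthesis x n : synthesis_domain x ->
  f n (synthesis_lim x) = (a n)^-1 * ip H x (e n) :> R.
Proof.
move=> /synthesis_cvg cx.
have fS N : (n < N)%N -> f n (synthesis N x) = (a n)^-1 * ip H x (e n) :> R.
  move=> nN; rewrite dual_sum.
  rewrite (bigD1_seq n) ?iota_uniq ?mem_index_iota ?(leq_trans nN)//=.
  rewrite dualZ fe oe eqxx/= big1 ?addr0 => [|i /negbTE ni].
    by rewrite -mulrA ip_null.
  by rewrite dualZ fe oe eq_sym ni mulr0.
apply: (@cvg_unique _ (@Rhausdorff R) ((fun N => f n (synthesis N x) : R) @ \oo)).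
  by apply: (cvg_comp (synthesis^~ x) (f n) cx); exact: cf.
by apply: cvg_near_cst; exists n.+1 => // N /= nN; rewrite fS.
Qed.

Lemma synthesis_inj : set_inj synthesis_domain synthesis_lim.
Proof.
move=> x y; rewrite !inE => Dx Dy xy; apply: (total_eq te) => n.
apply: (mulfI (invr_neq0 (a_neq0 n))).
by rewrite -!functional_synthesis// xy.
Qed.

Lemma measurable_synthesis_domain : measurable synthesis_domain.
Proof.
apply: measurable_frechet_cauchy => k m n; apply: continuous_borel_real.
apply: (@fnormB_continuous R H F q (synthesis m) (synthesis n) k frF);
  exact: synthesis_continuous.
Qed.

Lemma measurable_synthesis_lim : measurable_fun synthesis_domain synthesis_lim.
Proof.
apply: (@measurable_frechet_lim _ F q frF sepF _ (borel H) synthesis_domain synthesis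
  synthesis_lim); last exact: synthesis_cvg.
move=> N k c; apply: measurable_funTS; apply: continuous_borel_real.
apply: (@fnormB_continuous R H F q (synthesis N) (fun=> c) k frF).
  exact: synthesis_continuous.
by move=> x; exact: cvg_cst.
Qed.

Lemma synthesis_diagonal (j : {linear H -> H}) x :
  (forall x n, ip H (j x) (e n) = a n * ip H x (e n)) ->
  synthesis_domain (j x) /\ synthesis_lim (j x) = iota x.
Proof.
move=> jE; apply: synthesis_limP.
have -> : synthesis^~ (j x) = iota \o (proj e x \o s).
  apply/funext => N; rewrite /synthesis /= linear_sum; apply: eq_bigr => i _.
  by rewrite jE mulrA mulVf// mul1r linearZ.
have cs : s @ \oo --> \oo.
  move=> A [N _ NA]; exists N => // n /= Nn; apply: NA => /=.
  exact: leq_trans Nn (sN n).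
apply: (@cvg_comp _ _ _ (proj e x \o s) iota _ (nbhs x)); last exact: iotaC.
by apply: (@cvg_comp _ _ _ s (proj e x) _ \oo); last exact: cvg_proj.
Qed.

End synthesis.

(** * The Gaussian measure on the Hilbert space *)

Section analysis.
Context {R : realType} (H : hilbertType R) (F : tvsType R).
Variables (q : nat -> F -> R) (nu : set H -> \bar R) (iota : {linear H -> F}).
Variable gamma : probability (borel F) R.
Hypothesis nuH : canonical_gaussian nu.
Hypothesis awsF : abstract_wiener_space q nu iota.
Hypothesis gammaE : extends_image nu iota gamma.
Variables (e : nat -> H) (f : nat -> {linear F -> R^o}) (a : nat -> R) (s : nat -> nat).
Hypothesis oe : orthosystem e.
Hypothesis te : total_system e.
Hypothesis a01 : forall n, 0 < a n <= 1.
Hypothesis cf : forall n, continuous (f n).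
Hypothesis fe : forall n, represents iota (f n) (e n).
Hypothesis sN : forall N, (N <= s N)%N.
Hypothesis a_small : forall n,
  (gamma [set y | ((2 ^ n.+1)%:R^-1 <= `|a n * (f n y : R)|)%R]
     <= (1 / (2 ^ n.+1)%:R)%:E)%E.
Hypothesis s_small : forall N,
  (gamma [set y | (N.+1%:R^-1 <= q N (y - expansion iota e f (s N) y))%R]
     <= (1 / (2 ^ N.+1)%:R)%:E)%E.

Let frF : frechet q := aws_frechet awsF.
Let sepF : Defs.separable F := aws_separableF awsF.
Let sepH : Defs.separable H := aws_separableH awsF.
Let frH := frechet_hilbert H.
Let iotaC : continuous iota. Proof. by have [] := aws_embedding awsF. Qed.

Let a_neq0 n : a n != 0. Proof. by have /andP[/gt_eqF -> _] := a01 n. Qed.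

Local Notation syn := (synthesis iota e a s).
Local Notation E0 := (synthesis_domain q iota e a s).
Local Notation L := (synthesis_lim iota e a s).
Local Notation S := (expansion iota e f).

Definition analysis n (y : F) : H := partial_comb e (fun i => a i * (f i y : R)) 0 n.

Definition analysis_domain : set (borel F) :=
  [set y | frechet_cauchy (q := fun (_ : nat) (x : H) => `|x|) (analysis^~ y)].

(** The inverse of the synthesis map, with the value 0 where the series
    diverges. *)
Definition analysis_lim : borel F -> borel H :=
  fun y => xget 0 [set l : H | analysis^~ y @ \oo --> l].

Local Notation F0 := analysis_domain.
Local Notation T := analysis_lim.

Lemma analysis_cvg y : F0 y -> analysis^~ y @ \oo --> (T y : H).
Proof. by move=> /(frechet_complete frH) h; exact: (xgetPex 0 h). Qed.

Lemma analysis_limP y (l : H) : analysis^~ y @ \oo --> l -> F0 y /\ T y = l.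
Proof.
move=> yl; have Dy : F0 y by exact: (frechet_cvg_cauchy frH yl).
by split=> //; exact: (frechet_cvg_unique frH (analysis_cvg Dy) yl).
Qed.

Lemma analysis_continuous n : continuous (analysis n).
Proof.
apply: tvs_continuous_sum => i; apply: tvs_continuousZ => y.
by apply: cvgM; [exact: cvg_cst|exact: cf].
Qed.

(** If [e n] vanishes then so does [f n], by density of [range iota]. *)
Lemma functional_null n y : f n y * (e n != 0)%:R = f n y :> R.
Proof.
have [e0|] := eqVneq (e n) 0; last by rewrite mulr1.
have l0 : linear ((fun _ => 0) : F -> R^o) by move=> b u v; rewrite scaler0 addr0.
have c0 : continuous (mk_linear l0) by move=> z; exact: cvg_cst.
rewrite (dual_eq awsF (cf (n := n)) c0) => [|x]; first by rewrite mk_linearE mul0r.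
by rewrite fe e0 ip0l.
Qed.

Lemma ip_analysis y n : F0 y -> ip H (T y) (e n) = a n * (f n y : R).
Proof.
move=> /analysis_cvg cy.
apply: (@cvg_unique _ (@Rhausdorff R) (ip H (analysis m y) (e n) @[m --> \oo])).
  exact: cvg_ip.
apply: cvg_near_cst; exists n.+1 => // m /= nm.
by rewrite ip_partial_comb// nm mulr1n -mulrA functional_null.
Qed.

Lemma measurable_analysis_domain : measurable F0.
Proof.
apply: measurable_frechet_cauchy => k m n; apply: continuous_borel_real => y.
by apply: cvg_norm; apply: cvgB; exact: analysis_continuous.
Qed.

Lemma measurable_analysis_lim : measurable_fun setT T.
Proof.
have mF0 := measurable_analysis_domain.
rewrite -(setUv F0); apply/measurable_funU => //; first exact: measurableC.
split.
  apply: (@measurable_frechet_lim _ H _ frH sepH _ (borel F) F0 analysis T);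
    last exact: analysis_cvg.
  move=> n k c; apply: measurable_funTS; apply: continuous_borel_real => y.
  by apply: cvg_norm; apply: cvgB; [exact: analysis_continuous|exact: cvg_cst].
apply: (@eq_measurable_fun _ _ (borel F) (borel H) (~` F0) (fun=> 0)).
  move=> y; rewrite inE => nFy; rewrite /T xgetPN// => l yl; apply: nFy.
  by have [] := analysis_limP yl.
exact: measurable_cst.
Qed.

Definition analysis_full : set (borel F) :=
  F0 `&` [set y | (fun N => S (s N) y) @ \oo --> (y : F)].

Local Notation G := analysis_full.

Let expansion_set : set (borel F) := [set y | (fun N => S (s N) y) @ \oo --> (y : F)].

Let cont_diff k N : continuous (fun y => q k (S (s N) y - y)).
Proof.
apply: (@fnormB_continuous R F F q (S (s N)) id k frF).
  exact: expansion_continuous.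
by move=> y; exact: cvg_id.
Qed.

Let measurable_expansion_set : measurable expansion_set.
Proof.
have -> : expansion_set =
    \bigcap_k [set y | q k (S (s N) y - y) @[N --> \oo] --> (0 : R)].
  apply/seteqP; split=> y.
    by move=> /(fnormB_cvg0 frF) yk k _; exact: yk.
  by move=> yk; apply/(fnormB_cvg0 frF) => k; exact: yk.
apply: bigcapT_measurable => k; apply: measurable_cvg0 => N.
exact: continuous_borel_real.
Qed.

Let expansion_set_full : gamma expansion_set = 1%E.
Proof.
pose B N : set (borel F) := [set y | N.+1%:R^-1 <= q N (y - S (s N) y)].
apply: (borel_cantelli (B := B)) => //.
  move=> N; have mq := continuous_borel_real (@cont_diff N N).
  have := measurable_preimage mq (measurable_itv `[N.+1%:R^-1, +oo[).
  congr measurable; apply/seteqP; split=> y; rewrite /B /preimage/= in_itv/= andbT;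
    by rewrite (fnormBC frF).
move=> y [N0 yN0]; apply/(frechet_cvgP frF) => k r r0.
have [N1 N1r] := ltr_add_invr r0; rewrite add0r in N1r.
exists (maxn N0 (maxn k N1)) => // N /=; rewrite !geq_max => /and3P[NN0 Nk NN1].
rewrite (fnormBC frF) (le_lt_trans (fnorm_le frF _ Nk))//.
have /negP := yN0 N NN0; rewrite -ltNge => /lt_le_trans; apply.
by rewrite (le_trans _ (ltW N1r))// lef_pV2 ?posrE// ler_nat.
Qed.

Let geometric_sum n m : \sum_(m <= i < n) ((2 ^ i.+1)%:R^-1 : R) <= 1.
Proof.
have h k : \sum_(0 <= i < k) ((2 ^ i.+1)%:R^-1 : R) = 1 - (2 ^ k)%:R^-1.
  elim: k => [|k IH]; first by rewrite big_nil expn0 invr1 subrr.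
  rewrite big_nat_recr//= IH expnS natrM invfM.
  by move: ((2 ^ k)%:R^-1 : R) => x; lra.
have [mn|/ltnW nm] := leqP m n; last by rewrite big_geq.
apply: (@le_trans _ _ (\sum_(0 <= i < n) ((2 ^ i.+1)%:R^-1 : R))).
  by rewrite (@big_cat_nat _ _ _ m 0 n)//= lerDr sumr_ge0.
by rewrite h gerBl.
Qed.

(** By [a_small] and Borel-Cantelli the coefficients are eventually dominated by a
    geometric sequence. *)
Let analysis_domain_full : gamma F0 = 1%E.
Proof.
pose B n : set (borel F) := [set y | (2 ^ n.+1)%:R^-1 <= `|a n * (f n y : R)|].
apply: (borel_cantelli (B := B)) => //.
- move=> n; have mB : continuous (fun y : F => `|a n * (f n y : R)|).
    by move=> y; apply: cvg_norm; apply: cvgM; [exact: cvg_cst|exact: cf].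
  have := measurable_preimage (continuous_borel_real mB)
    (measurable_itv `[(2 ^ n.+1)%:R^-1, +oo[).
  by congr measurable; apply/seteqP; split=> y; rewrite /B /preimage/= in_itv/= andbT.
- exact: measurable_analysis_domain.
- move=> y [N yN].
  have cs i : (N <= i)%N -> (a i * (f i y : R)) ^+ 2 <= (2 ^ i.+1)%:R^-1.
    move=> Ni; have /negP := yN i Ni; rewrite -ltNge => /ltW small.
    rewrite -real_normK ?num_real// expr2.
    have i1 : (2 ^ i.+1)%:R^-1 <= 1 :> R.
      by rewrite invf_le1 ?ltr0n ?expn_gt0// ler1n expn_gt0.
    by rewrite -[leRHS]mulr1 ler_pM// (le_trans small).
  pose C := \sum_(0 <= i < N) (a i * (f i y : R)) ^+ 2.
  have bound n : \sum_(0 <= i < n) (a i * (f i y : R)) ^+ 2 <= C + 1.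
    have [nN|Nn] := leqP n N.
      rewrite /C (@big_cat_nat _ _ _ n 0 N)//= -addrA lerDl addr_ge0//.
      by rewrite sumr_ge0// => i _; rewrite sqr_ge0.
    rewrite (@big_cat_nat _ _ _ N 0 n) ?(ltnW Nn)//= lerD2l.
    rewrite (le_trans _ (geometric_sum n N))//.
    by apply: ler_sum_nat => i /andP[Ni _]; exact: cs.
  have [x yx _] := riesz_fischer oe bound.
  by have [] := analysis_limP yx.
Qed.

Lemma measurable_analysis_full : measurable G.
Proof. exact: measurableI measurable_analysis_domain measurable_expansion_set. Qed.

Lemma analysis_full1 : gamma G = 1%E.
Proof.
apply: eq_trans expansion_set_full.
exact: full_setI measurable_analysis_domain analysis_domain_full _.
Qed.

Lemma analysisK y : G y -> E0 (T y) /\ L (T y) = y.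
Proof.
move=> [Fy Sy]; apply: (synthesis_limP frF).
suff -> : syn^~ (T y) = (fun N => S (s N) y) by [].
apply/funext => N; apply: eq_bigr => i _.
by rewrite ip_analysis// mulrA mulVf// mul1r.
Qed.

Lemma synthesisK x : E0 x -> G (L x) /\ T (L x) = x.
Proof.
move=> Ex; have fL n := functional_synthesis frF oe cf fe sN n Ex.
have [FL TL] : F0 (L x) /\ T (L x) = x.
  apply: (@analysis_limP (L x) x).
  have -> : analysis^~ (L x) = proj e x.
    apply/funext => n; apply: eq_bigr => i _.
    by rewrite fL// mulrA mulfV// mul1r.
  exact: (cvg_proj oe te).
split=> //; split=> //=.
have -> : (fun N => S (s N) (L x)) = syn^~ x.
  by apply/funext => N; apply: eq_bigr => i _; rewrite fL.
exact: (synthesis_cvg frF).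
Qed.

(** As [L] is inverse to [T], images under [L] are preimages under a Borel map, and
    hence Borel. *)
Lemma image_synthesis (A : set (borel H)) : A `<=` E0 -> L @` A = G `&` T @^-1` A.
Proof.
move=> AE; apply/seteqP; split=> [_ [x Ax <-]|y [Gy Ty]].
  by have [GL TL] := synthesisK (AE _ Ax); split=> //; rewrite /preimage/= TL.
by exists (T y) => //; have [] := analysisK Gy.
Qed.

Definition hilbert_law : probability (borel H) R := law gamma measurable_analysis_lim.

Local Notation nu1 := hilbert_law.

Lemma synthesis_domain_full : nu1 E0 = 1%E.
Proof.
have mE : measurable E0 by exact: measurable_synthesis_domain.
rewrite /nu1 lawE -(full_setI measurable_analysis_full analysis_full1); last first.
  exact: measurable_preimage measurable_analysis_lim mE.
rewrite (_ : G `&` _ = G) ?analysis_full1//; apply/setIidl => y Gy.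
by have [] := analysisK Gy.
Qed.

Lemma law_synthesis (B : set (borel F)) : measurable B ->
  gamma B = nu1 (E0 `&` L @^-1` B).
Proof.
move=> mB; have mE : measurable E0 by exact: measurable_synthesis_domain.
have mL : measurable_fun E0 L by exact: measurable_synthesis_lim.
have mT : measurable (T @^-1` (E0 `&` L @^-1` B)).
  by apply: measurable_preimage measurable_analysis_lim _; exact: mL.
apply: (eq_trans (esym (full_setI measurable_analysis_full analysis_full1 mB))).
apply: (eq_trans _ (full_setI measurable_analysis_full analysis_full1 mT)).
apply: (congr1 gamma); apply/seteqP.
split=> y [Gy By]; split=> //; have [ET LT] := analysisK Gy.
  by split=> //; rewrite /preimage/= LT.
by case: By => _; rewrite /preimage/= LT.
Qed.

Lemma measure_isomorphism_synthesis :
  measure_isomorphism nu1 gamma E0 (L @` E0) L.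
Proof.
have mE : measurable E0 by exact: measurable_synthesis_domain.
have mG := measurable_analysis_full.
have EG : L @` E0 = G.
  rewrite image_synthesis//; apply/setIidl => y Gy.
  by have [] := analysisK Gy.
split.
- split=> //; [exact: synthesis_domain_full|by rewrite EG|].
  by rewrite EG; exact: analysis_full1.
- split=> //; exact: synthesis_inj.
- exact: measurable_synthesis_lim.
- move=> A mA AE; rewrite image_synthesis//; apply: measurableI => //.
  exact: measurable_preimage measurable_analysis_lim mA.
- exact: law_synthesis.
Qed.

Variable j : {linear H -> H}.
Hypothesis jC : continuous j.
Hypothesis jE : forall x n, ip H (j x) (e n) = a n * ip H x (e n).

Lemma hilbert_law_degenerate (phi : {linear H -> R^o}) (B : set (measurableTypeR R)) :
  continuous phi -> (forall x, phi (j x) = 0 :> R) -> nu1 (phi @^-1` B) = \d_(0 : R) B.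
Proof.
move=> cphi phij.
have -> : (phi : H -> R) = fun=> 0.
  apply: (dense_eq (@Rhausdorff R) (diagonal_dense oe te a01 jE) cphi) phij.
  by move=> x; exact: cvg_cst.
rewrite diracE; have [B0|B0] := pselect (B 0).
  by rewrite mem_set// (_ : _ @^-1` _ = setT) ?probability_setT//; apply/seteqP; split.
by rewrite memNset// (_ : _ @^-1` _ = set0) ?measure0//; apply/seteqP; split.
Qed.

Lemma cvg_proj_neq0 w : w != 0 -> exists n0, forall n, (n0 <= n)%N -> proj e w n != 0.
Proof.
move=> w0; have w1 : 0 < `|w| by rewrite normr_gt0.
have /cvgr_gt/(_ _ w1)[n0 _ n0P] := cvg_norm_proj oe te (x := w).
by exists n0 => n /n0P /=; rewrite normr_gt0.
Qed.

(** [phi \o T] is a pointwise limit of the continuous functionals [psi n] of [F],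
    whose laws are normal with deviations converging to the norm of [w]. *)
Lemma hilbert_law_normal (phi : {linear H -> R^o}) w (B : set (measurableTypeR R)) :
  continuous phi -> (forall x, phi (j x) = ip H w x) -> w != 0 -> measurable B ->
  nu1 (phi @^-1` B) = normal_prob 0 `|w| B.
Proof.
move=> cphi phij w0 mB; have [n0 n0P] := cvg_proj_neq0 w0.
pose psi n (y : F) : R := \sum_(0 <= i < n) ip H w (e i) * (f i y : R).
have psi_lin n : linear (psi n : F -> R^o).
  move=> b x y; have E : psi n (b *: x + y) = b * psi n x + psi n y.
    rewrite /psi mulr_sumr -big_split/=; apply: eq_bigr => i _.
    by rewrite dualD dualZ; ring.
  exact: E.
have cpsi n : continuous (mk_linear (psi_lin n)).
  have : continuous (fun y : F => \sum_(0 <= i < n) (ip H w (e i) * (f i y : R)) : R^o).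
    apply: (@tvs_continuous_sum R F R^o) => i y.
    by apply: cvgM; [exact: cvg_cst|exact: cf].
  exact.
have psiE n : represents iota (mk_linear (psi_lin n)) (proj e w n).
  move=> x; rewrite mk_linearE /psi ip_suml; apply: eq_bigr => i _.
  by rewrite ipZl fe.
have mphi : measurable_fun setT (phi : borel H -> R) by exact: continuous_borel_real.
have cvg_psi y : F0 y -> psi n y @[n --> \oo] --> (phi (T y) : R).
  move=> /analysis_cvg Ty.
  have -> : (fun n => psi n y) = (fun n => phi (analysis n y) : R).
    apply/funext => n; rewrite dual_sum; apply: eq_bigr => i _.
    by rewrite dualZ -phij (diagonal_basis oe te jE) dualZ; ring.
  by apply: (cvg_comp (analysis^~ y) phi Ty); exact: cphi.
rewrite /nu1 lawE normal_prob_scale ?normr_gt0//.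
apply: (@law_of_limit _ _ _ (borel F) (measurableTypeR R) gamma (normal_prob 0 1)
  (fun n => psi (n + n0)%N) (phi \o T)
  (fun n x => `|proj e w (n + n0)| * x) (fun x => `|w| * x) F0 setT) => //.
- move=> n; exact: (continuous_borel_real (cpsi (n + n0)%N)).
- exact: measurableT_comp mphi measurable_analysis_lim.
- by move=> n; exact: measurable_scale.
- exact: measurable_scale.
- exact: measurable_analysis_domain.
- exact: probability_setT.
- move=> y Fy; have := cvg_psi y Fy.
  by rewrite -(cvg_shiftn n0).
- move=> x _; apply: cvgM; last exact: cvg_cst.
  have := cvg_norm_proj oe te (x := w).
  by rewrite -(cvg_shiftn n0).
- move=> n c; have p0 := n0P _ (leq_addl n n0).
  rewrite (gaussian_law nuH gammaE (cpsi _) (psiE _) p0)//.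
  by rewrite normal_prob_scale ?normr_gt0.
Qed.

Lemma hilbert_law_riesz (phi : {linear H -> R^o}) : continuous phi ->
  exists w, forall x, phi (j x) = ip H w x.
Proof.
move=> cphi.
have lin : linear (phi \o j : H -> R^o) by move=> b x y /=; rewrite !linearP.
have [|w wE] := riesz (f := mk_linear lin) sepH; last by exists w.
by move=> x; apply: continuous_comp; [exact: jC|exact: cphi].
Qed.

Lemma hilbert_law_gaussian : centered_gaussian nu1.
Proof.
move=> phi cphi; have [w wE] := hilbert_law_riesz cphi.
have [w0|w0] := eqVneq w 0; [right|left].
  by move=> B _; apply: hilbert_law_degenerate => // x; rewrite wE w0 ip0l.
exists `|w|; first by rewrite normr_gt0.
by move=> B mB; exact: hilbert_law_normal.
Qed.

Lemma hilbert_law_Lnorm (phi : {linear H -> R^o}) w :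
  continuous phi -> (forall x, phi (j x) = ip H w x) ->
  Lnorm nu1 2%:E (fun x => (phi x)%:E) = `|w|%:E.
Proof.
move=> cphi phij.
have mphi : measurable_fun setT (phi : borel H -> measurableTypeR R).
  exact: continuous_borel_real.
have msqr : measurable_fun setT (fun t : measurableTypeR R => (t ^+ 2)%:E).
  by apply/measurable_EFinP; exact: measurable_funX.
have sqr0 (t : R) : (0 <= (t ^+ 2)%:E)%E by rewrite lee_fin sqr_ge0.
have I2 : (\int[nu1]_x ((phi x : R) ^+ 2)%:E = (`|w| ^+ 2)%:E)%E.
  rewrite -(ge0_integral_law nu1 mphi msqr sqr0).
  have [w0|w0] := eqVneq w 0.
    transitivity (\int[\d_(0%R : measurableTypeR R)]_t ((t : R) ^+ 2)%:E)%E.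
      apply: eq_measure_integral => A mA _.
      by apply: hilbert_law_degenerate => // x; rewrite phij w0 ip0l.
    by rewrite integral_dirac// diracT mul1e w0 normr0.
  have nw0 : 0 < `|w| by rewrite normr_gt0.
  transitivity (\int[law (normal_prob 0%R 1%R) (measurable_scale `|w|)]_t
      ((t : R) ^+ 2)%:E)%E.
    apply: eq_measure_integral => A mA _.
    by rewrite [RHS]/= -[RHS](normal_prob_scale nw0 mA); exact: hilbert_law_normal.
  rewrite ge0_integral_law//.
  under eq_integral do rewrite exprMn EFinM.
  by rewrite ge0_integralZl// ?second_moment_normal ?mule1// lee_fin.
rewrite unlock /Lnorm.
under eq_integral do rewrite abse_EFin poweR_EFin powR_mulrn// real_normK ?num_real//.
by rewrite I2 poweR_EFin powR12_sqrt ?sqr_ge0// sqrtr_sqr normr_id.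
Qed.

(** The left-hand side is the value at [x] of the functional [phi] of unit variance
    that corresponds to the direction of the partial sum [u]. *)
Lemma cm_norm_ge x N :
  (`|partial_comb e (fun i => (a i)^-1 * ip H x (e i)) 0 N|%:E <= cm_norm nu1 x)%E.
Proof.
set t := fun i => (a i)^-1 * ip H x (e i); set u := partial_comb e t 0 N.
pose v := `|u|^-1 *: partial_comb e (fun i => (a i)^-1 * t i) 0 N.
pose phi : {linear H -> R^o} := ip_form v.
have cphi : continuous phi by exact: ip_continuous.
have phij y : phi (j y) = ip H (`|u|^-1 *: u) y.
  rewrite /= /ip_form ipZr ipZl; congr (_ * _).
  rewrite ip_sumr ip_suml; apply: eq_bigr => i _.
  by rewrite ipZl ipZr jE (ipC y); field.
have phix : phi x = `|u| :> R.
  rewrite /= /ip_form ipZr ip_sumr.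
  have -> : \sum_(0 <= i < N) ip H x (((a i)^-1 * t i) *: e i) = `|u| ^+ 2.
    rewrite norm_partial_comb//; apply: eq_bigr => i _.
    rewrite ipZr /t; have := ip_null e x i.
    by move: (ip H x (e i)) ((e i != 0)%:R : R) => p b pb; rewrite -{2}pb; ring.
  have [->|u0] := eqVneq `|u| 0; first by rewrite invr0 mul0r.
  by rewrite expr2 mulrA mulVf// mul1r.
apply: ereal_sup_ubound; exists phi; last by rewrite phix.
split=> //; rewrite (hilbert_law_Lnorm cphi phij) lee_fin normrZ normfV normr_id.
by have [->|u0] := eqVneq `|u| 0; rewrite ?mulr0// mulVf.
Qed.

Lemma cm_norm_diagonal x : cm_norm nu1 (j x) = `|x|%:E.
Proof.
apply/eqP; rewrite eq_le; apply/andP; split.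
  apply: ge_ereal_sup => _ [phi [cphi phi1] <-].
  have [w wE] := hilbert_law_riesz cphi.
  rewrite (hilbert_law_Lnorm cphi wE) lee_fin in phi1.
  rewrite lee_fin wE (le_trans (ler_norm _))// (le_trans (cauchy_schwarz _ _))//.
  by rewrite ler_piMl.
have cN : (`|proj e x N|%:E @[N --> \oo] --> `|x|%:E)%E.
  by apply: cvg_EFin; [exact: nearW|exact: cvg_norm_proj].
rewrite -(cvg_lim _ cN)//; apply: lime_le; first by apply/cvg_ex; eexists; exact: cN.
apply: nearW => N; rewrite (le_trans _ (cm_norm_ge _ N))// lee_fin.
rewrite le_eqVlt; apply/orP; left; apply/eqP; congr `|_|.
by apply: eq_bigr => i _; rewrite jE mulrA mulVf// mul1r.
Qed.

(** If the Cameron-Martin norm of [x] is finite then, by [cm_norm_ge], the rescaled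
    coordinates [t] of [x] are square-summable, hence those of some [y]. *)
Lemma cm_space_diagonal : range j = cm_space nu1.
Proof.
apply/seteqP; split=> [_ [x _ <-]|x xoo].
  by rewrite /cm_space/= cm_norm_diagonal ltry.
have xfin : cm_norm nu1 x \is a fin_num.
  by rewrite ge0_fin_numE// (le_trans _ (cm_norm_ge x 0))// lee_fin.
set t := fun i => (a i)^-1 * ip H x (e i).
have tM n : \sum_(0 <= i < n) t i ^+ 2 <= fine (cm_norm nu1 x) ^+ 2.
  have := cm_norm_ge x n; rewrite -[cm_norm _ _]fineK// lee_fin => h.
  have -> : \sum_(0 <= i < n) t i ^+ 2 = `|partial_comb e t 0 n| ^+ 2.
    rewrite norm_partial_comb//; apply: eq_bigr => i _.
    have := ip_null e x i; rewrite /t expr2.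
    by move: (ip H x (e i)) ((e i != 0)%:R : R) => p b pb; rewrite -{2}pb; ring.
  by rewrite ler_pXn2r// nnegrE// (le_trans _ h).
have [y _ yE] := riesz_fischer oe tM; exists y => //.
apply: (total_eq te) => i.
by rewrite jE yE /t -!mulrA ip_null mulrA mulfV// mul1r.
Qed.

End analysis.

(** * The Hilbert space model *)

Theorem corollary3p5 (R : realType) (H : hilbertType R) (F : tvsType R)
    (q : nat -> F -> R) (nu : set H -> \bar R) (iota : {linear H -> F})
    (gamma : probability (borel F) R)
    (nuH : canonical_gaussian nu)
    (awsF : abstract_wiener_space q nu iota)
    (gammaE : extends_image nu iota gamma) :
  exists (E : hilbertType R) (nu1 : probability (borel E) R)
         (j : {linear H -> E}) (E0 : set (borel E)) (L : borel E -> borel F),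
    [/\ separable E, centered_gaussian nu1 & dense_embedding j] /\
    (range j = cm_space nu1 /\ forall h, cm_norm nu1 (j h) = `|h|%:E) /\
    [/\ measurable E0, nu1 E0 = 1%E, measurable_fun E0 L,
        @linear_on R E F E0 L & set_inj E0 L] /\
    (forall B : set (borel F), measurable B ->
       gamma B = nu1 (E0 `&` L @^-1` B)) /\
    (range j `<=` E0 /\ forall h, L (j h) = iota h) /\
    measure_isomorphism nu1 gamma E0 (L @` E0) L.
Proof.
have frF := aws_frechet awsF; have sepF := aws_separableF awsF.
have [g [h [e [f [[cg gP gh] [oe te hE cf fe]]]]]] := gaussian_basis awsF.
have /choice[M MP] n : exists M : R, 0 < M /\
    (gamma [set y | (M <= `|(f n y : R)|)%R] <= (1 / (2 ^ n.+1)%:R)%:E)%E.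
  have mf : measurable_fun setT (f n : borel F -> R) by exact: continuous_borel_real.
  have pos : 0 < 1 / (2 ^ n.+1)%:R :> R by rewrite divr_gt0// ltr0n expn_gt0.
  by have [M M0 MP] := tail_small gamma mf pos; exists M.
(* The factor [2 ^ n.+1] serves the Borel-Cantelli lemma, the factor [1 + M n]
   brings the bound on [f n] below 1, and both keep [a n] at most 1. *)
pose a n : R := ((2 ^ n.+1)%:R * (1 + M n))^-1.
have pow1 n : 1 <= (2 ^ n.+1)%:R :> R by rewrite ler1n expn_gt0.
have M0 n : 0 < M n by have [] := MP n.
have a01 n : 0 < a n <= 1.
  have d1 : 1 <= (2 ^ n.+1)%:R * (1 + M n) :> R.
    by rewrite -[leLHS]mulr1 ler_pM// lerDl ltW.
  by rewrite invr_gt0 (lt_le_trans ltr01 d1)/= invf_le1// (lt_le_trans ltr01 d1).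
have a_small n : (gamma [set y | ((2 ^ n.+1)%:R^-1 <= `|a n * (f n y : R)|)%R]
    <= (1 / (2 ^ n.+1)%:R)%:E)%E.
  apply: le_trans (MP n).2.
  have mabs (c : R) : measurable [set y : borel F | c <= `|(f n y : R)|].
    have cabs : continuous (fun y : F => `|(f n y : R)|).
      by move=> y; apply: cvg_norm; exact: cf.
    have := measurable_preimage (continuous_borel_real cabs) (measurable_itv `[c, +oo[).
    by congr measurable; apply/seteqP; split=> y; rewrite /preimage/= in_itv/= andbT.
  have aE (y : F) : ((2 ^ n.+1)%:R^-1 <= `|a n * (f n y : R)|) =
      (1 + M n <= `|(f n y : R)|).
    have /andP[a0 _] := a01 n.
    rewrite normrM (gtr0_norm a0) /a invfM -mulrA ler_pMr; last first.
      by rewrite invr_gt0 (lt_le_trans ltr01 (pow1 n)).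
    by rewrite mulrC ler_pdivlMr ?mul1r// addr_gt0.
  have -> : [set y : borel F | (2 ^ n.+1)%:R^-1 <= `|a n * (f n y : R)|] =
            [set y : borel F | 1 + M n <= `|(f n y : R)|].
    by apply/seteqP; split=> y /=; rewrite aE.
  apply: le_measure; rewrite ?inE//.
  by move=> y /=; apply: le_trans; rewrite lerDr.
have /choice[s sP] N : exists m, (N <= m)%N /\
    (gamma [set y | (N.+1%:R^-1 <= q N (y - expansion iota e f m y))%R]
       <= (1 / (2 ^ N.+1)%:R)%:E)%E.
  have pos : 0 < 1 / (2 ^ N.+1)%:R :> R by rewrite divr_gt0// ltr0n expn_gt0.
  have pos' : 0 < N.+1%:R^-1 :> R by rewrite invr_gt0.
  have [N0 NP] := expansion_cvg_measure nuH awsF gammaE cg gP gh oe hE cf fe N pos' pos.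
  by exists (maxn N N0); rewrite leq_maxl; split=> //; apply: NP; rewrite leq_maxr.
have sN N : (N <= s N)%N by have [] := sP N.
have s_small N := (sP N).2.
have [j [jC jE]] := diagonal_exists oe te a01.
have iotaC : continuous iota by have [] := aws_embedding awsF.
exists H, (hilbert_law gamma awsF e a cf), j.
exists (synthesis_domain q iota e a s), (synthesis_lim iota e a s).
split; [split|split; [split|split; [split|split; [|split]]]].
- exact: aws_separableH awsF.
- exact: hilbert_law_gaussian.
- split=> //; first exact: (diagonal_injective te a01 jE).
  exact: (diagonal_dense oe te a01 jE).
- exact: cm_space_diagonal.
- exact: cm_norm_diagonal.
- exact: measurable_synthesis_domain.
- exact: synthesis_domain_full.
- exact: measurable_synthesis_lim.
- exact: synthesis_linear_on.
- exact: (synthesis_inj frF oe te a01 cf fe sN).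
- exact: law_synthesis.
- split=> [_ [x _ <-]|x].
    by have [] := synthesis_diagonal frF iotaC oe te a01 sN x jE.
  by have [] := synthesis_diagonal frF iotaC oe te a01 sN x jE.
- exact: measure_isomorphism_synthesis.
Qed.
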